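(* Let $1\le r\le d<\infty$ be integers, let $\Theta\in\mathbb{R}^{d\times r}$ satisfy $\Theta^{\mathsf T}\Theta=I_r$, and let $g:\mathbb{R}^r\to\mathbb{R}$ be Lipschitz continuous with constant $C$ (with respect to the Euclidean norm). Let $f(x)=g(\Theta^{\mathsf T}x)$ for $x\in\mathbb{R}^d$, with $x\sim\mathcal{N}(0,I_d)$, and suppose $\sigma^2=\mathrm{Var}(f(x))>0$. Then $$\nu(f)\le r\times\Bigl(\frac{C}{\sigma}\Bigr)^2,$$ where $\sigma^2$ does not depend on $d$ (for fixed $r$ and $g$).
   Context: Mean dimension: let $x=(x_1,\dots,x_d)$ have independent components (here $x\sim\mathcal{N}(0,I_d)$) and let $f$ be measurable with $E(f(x)^2)<\infty$. For $u\subseteq\{1,\dots,d\}$ the ANOVA components are defined recursively by $f_u(x)=E(f(x)\mid x_u)-\sum_{v\subsetneq u}f_v(x)$, where $x_u=(x_j)_{j\in u}$, so $f=\sum_u f_u$, the $f_u$ are mutually orthogonal in $L^2$, and $f_\emptyset=E(f(x))$. Put $\sigma_u^2=E(f_u(x)^2)$ for $u\neq\emptyset$ and $\sigma^2_\emptyset=0$, so $\sigma^2=\mathrm{Var}(f(x))=\sum_u\sigma_u^2$. When $\sigma^2>0$, the mean dimension of $f$ is $\nu(f)=\sum_u|u|\sigma_u^2\big/\sum_u\sigma_u^2$. *)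

(* Defs.v *)
From HB Require Import structures.
From mathcomp Require Import all_boot all_order all_algebra.
From mathcomp Require Import all_classical all_reals all_analysis.

Set Implicit Arguments.
Unset Strict Implicit.
Unset Printing Implicit Defensive.

Import Order.TTheory GRing.Theory Num.Theory.
Import numFieldNormedType.Exports.

Local Open Scope classical_set_scope.
Local Open Scope ring_scope.

(* The norm `|z| of the library on 'cV[R]_r is the sup norm, hence the
   following. *)
Definition euclid_norm (R : realType) (r : nat) (z : 'cV[R]_r) : R :=
  Num.sqrt (\sum_(i < r) z i ord0 ^+ 2).

Definition lipschitz_euclid (R : realType) (r : nat) (C : R)
    (g : 'cV[R]_r -> R) : Prop :=
  forall z z' : 'cV[R]_r, `|g z - g z'| <= C * euclid_norm (z - z').

Section random_vectors.
Context (disp : measure_display) (T : measurableType disp) (R : realType).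
Variable P : probability T R.

Definition mutually_independent (d : nat) (X : 'I_d -> {RV P >-> R}) : Prop :=
  forall (J : {set 'I_d}) (A : 'I_d -> set R),
    (forall j, j \in J -> measurable (A j)) ->
    (P (\bigcap_(j in [set` J]) (X j @^-1` A j))
     = \prod_(j in J) P (X j @^-1` A j))%E.

(* x ~ N(0, I_d) *)
Definition standard_gaussian (d : nat) (X : 'I_d -> {RV P >-> R}) : Prop :=
  mutually_independent X /\
  forall (j : 'I_d) (A : set R), measurable A ->
    distribution P (X j) A = normal_prob 0 1 A.

Definition random_vector (d : nat) (X : 'I_d -> {RV P >-> R}) (w : T)
    : 'cV[R]_d := \col_j X j w.

(* The sigma-algebra on T generated by x_u = (x_j)_(j in u); it is the trivial
   one when u is empty. *)
Definition sigma_coord (d : nat) (X : 'I_d -> {RV P >-> R})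
    (u : {set 'I_d}) : set (set T) :=
  <<s \bigcup_(j in [set` u])
        preimage_set_system [set: T] (X j) measurable >>.

(* Z is a version of E(Y | G), for a sub-sigma-algebra G *)
Definition is_cond_exp (G : set (set T)) (Y Z : T -> R) : Prop :=
  [/\ preimage_set_system [set: T] Z measurable `<=` G,
      P.-integrable [set: T] (EFin \o Z) &
      forall A : set T, G A ->
        (\int[P]_(w in A) (Z w)%:E = \int[P]_(w in A) (Y w)%:E)%E].

(* A chosen version of E(Y | G).  For integrable Y versions exist and any two
   of them agree P-almost everywhere, so the expectations below do not depend
   on the choice. *)
Definition cond_exp (G : set (set T)) (Y : T -> R) : T -> R :=
  xget (fun=> 0) [set Z | is_cond_exp G Y Z].

Section anova.
Variables (d : nat) (X : 'I_d -> {RV P >-> R}) (f : 'cV[R]_d -> R).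

(* The bound n on the recursion depth is immaterial as soon as #|u| < n;
   the recursion defining the ANOVA components is anova_compE below. *)
Fixpoint anova_rec (n : nat) (u : {set 'I_d}) (w : T) : R :=
  if n is m.+1 then
    cond_exp (sigma_coord X u) (f \o random_vector X) w
    - \sum_(v : {set 'I_d} | v \proper u) anova_rec m v w
  else 0.

(* The random variable f_u(x) *)
Definition anova_comp (u : {set 'I_d}) : T -> R := anova_rec #|u|.+1 u.

Lemma anova_rec_stable (n m : nat) (u : {set 'I_d}) (w : T) :
  (#|u| < n)%N -> (#|u| < m)%N -> anova_rec n u w = anova_rec m u w.
Proof.
elim: n m u => [//|n IH] [//|m] u un um /=.
congr (_ - _); apply: eq_bigr => v vu.
by apply: IH; rewrite (leq_trans (proper_card vu)).
Qed.

Lemma anova_compE (u : {set 'I_d}) (w : T) :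
  anova_comp u w
  = cond_exp (sigma_coord X u) (f \o random_vector X) w
    - \sum_(v : {set 'I_d} | v \proper u) anova_comp v w.
Proof.
rewrite {1}/anova_comp /=; congr (_ - _); apply: eq_bigr => v vu.
by apply: anova_rec_stable; rewrite ?proper_card.
Qed.

Definition anova_var (u : {set 'I_d}) : R :=
  if u == finset.set0 then 0
  else fine ('E_P[fun w => (anova_comp u w ^+ 2)%R])%E.

Definition mean_dimension : R :=
  (\sum_(u : {set 'I_d}) #|u|%:R * anova_var u)
  / \sum_(u : {set 'I_d}) anova_var u.

End anova.

End random_vectors.

(* Main.v *)
(* Write [V] for the Gaussian vector and [average u f] for the function obtained
   from [f] by integrating out the coordinates outside [u]; by independence and
   Fubini it represents E(f(x) | x_u), these operators are self-adjoint, and they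
   satisfy [average u (average v f) = average (u :&: v) f].  Hence the ANOVA
   components are orthogonal, and the sum of |u| sigma_u^2 is the sum over j of
   E(f - E(f | x_(-j)))^2.  The conditional expectation is the best approximation
   by functions of x_(-j), so each term is at most E(f(x) - f(x with x_j := 0))^2,
   hence at most C^2 |Theta_j|^2 E(x_j^2), with Theta_j the j-th row of Theta; the
   squared norms of the rows sum to r.  The variance depends only on r and g, as
   [Theta^T x] is a standard Gaussian vector: Theta is reduced to the first r unit
   vectors by plane rotations, which preserve the Gaussian measure. *)

Require Import Defs.
From HB Require Import structures.
From mathcomp Require Import all_boot all_order all_algebra.
From mathcomp Require Import all_classical all_reals all_analysis.
From mathcomp Require Import measurable_realfun ring lra.

Set Implicit Arguments.
Unset Strict Implicit.
Unset Printing Implicit Defensive.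

Import Order.TTheory GRing.Theory Num.Theory.
Import numFieldNormedType.Exports.

Local Open Scope classical_set_scope.
Local Open Scope ring_scope.

(** * Coordinate sigma-algebras *)

(** Conditional expectations are determined only up to null sets, whereas orthogonality is proved by
    averaging the components again. Hence the algebra is carried out with functions defined at every
    point, in a class that contains [f], is closed under averaging, sums and differences, and
    consists of square-integrable functions measurable for the coordinates they depend on: the
    Lipschitz functions. The l1 distance serves for this class because its constants never reach the
    bound; the Euclidean constant [C] enters the bound only through the change of a single
    coordinate. The chosen versions [cond_exp] are then identified with averages almost everywhere.
    Laws of vectors are compared on rectangles, so independence appears as a product formula, and
    splitting the space into the coordinates in [u] and the others is replaced by [mix], which
    merges two independent copies of the vector. Rotation invariance and the second moment of the
    Gaussian are obtained from Lebesgue measure by shears and by comparison with a wider normal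
    density. *)

Definition coord_sets (R : realType) (d : nat) (u : {set 'I_d}) :
    set (set 'cV[R]_d) :=
  \bigcup_(j in [set` u])
    preimage_set_system [set: 'cV[R]_d] (fun x => x j ord0) measurable.

Notation coordType R u := (g_sigma_algebraType (@coord_sets R _ u)).
Notation vecType R d := (g_sigma_algebraType (@coord_sets R d [set: 'I_d]%SET)).

Definition rect (R : realType) (d : nat) (A : 'I_d -> set R) : set 'cV[R]_d :=
  [set x | forall j, A j (x j ord0)].

Definition mix (R : realType) (d : nat) (u : {set 'I_d}) (x y : 'cV[R]_d) :
    'cV[R]_d :=
  \col_j (if j \in u then x j ord0 else y j ord0).

(** Stated as an invariance rather than a factorisation, so that it can be used for rewriting; with
    [S := Prop] it applies to sets. *)
Definition depends_on (R : realType) (d : nat) (u : {set 'I_d}) (S : Type)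
    (phi : 'cV[R]_d -> S) : Prop :=
  forall x y, phi (mix u x y) = phi x.

Section coordinates.
Context (R : realType) (d : nat).
Implicit Types (u v : {set 'I_d}) (x y z : 'cV[R]_d).

Lemma mixE u x y j k : mix u x y j k = if j \in u then x j ord0 else y j ord0.
Proof. by rewrite mxE. Qed.

(** The pointwise form of the composition rule [average_average]. *)
Lemma mix_mix u v x y z :
  mix v (mix u x y) z = mix (u :&: v)%SET x (mix v y z).
Proof.
by apply/colP => j; rewrite !mixE inE; case: (j \in u); case: (j \in v).
Qed.

Lemma mix_mixl u x y z : mix u (mix u x y) z = mix u x z.
Proof. by apply/colP => j; rewrite !mixE; case: (j \in u). Qed.

Lemma mixT x y : mix [set: 'I_d]%SET x y = x.
Proof. by apply/colP => j; rewrite mixE inE (ord1 _). Qed.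

Lemma depends_onW u v (S : Type) (phi : 'cV[R]_d -> S) :
  u \subset v -> depends_on u phi -> depends_on v phi.
Proof.
move=> /fintype.subsetP uv uphi x y; rewrite -(uphi x 0) -(uphi (mix v x y) 0).
by congr phi; apply/colP => j; rewrite !mixE; case: ifP => // /uv ->.
Qed.

Lemma measurable_coord u j : j \in u ->
  measurable_fun [set: coordType R u] (fun x : 'cV[R]_d => x j ord0).
Proof.
move=> ju _ B mB; rewrite setTI; apply: sub_sigma_algebra.
by exists j => //; exists B => //; rewrite setTI.
Qed.

(** The sets with this property form a sigma-algebra that contains the generators. *)
Lemma depends_on_coord u (B : set 'cV[R]_d) :
  (coord_sets u).-sigma.-measurable B -> depends_on u B.
Proof.
move: B; apply: (@smallest_sub _ _ _ [set B | depends_on u B]).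
- split => [x y //|B uB x y|F uF x y] /=.
  + by rewrite /setD /= uB.
  + by apply/propext; split => -[n _ Fn]; exists n => //; move: Fn; rewrite uF.
- move=> _ [j ju [B mB <-]] x y; rewrite /preimage /setI /= mixE.
  by rewrite (_ : j \in u).
Qed.

Lemma coord_sigmaS u v : u \subset v ->
  <<s (@coord_sets R d u) >> `<=` <<s (@coord_sets R d v) >>.
Proof.
move=> /fintype.subsetP uv; apply: sub_sigma_algebra2 => A [j ju jA].
by exists j => //=; exact: uv.
Qed.

Lemma measurable_to_coord u dT (T : measurableType dT) (V : T -> 'cV[R]_d) :
  (forall j, j \in u -> measurable_fun setT (fun w => V w j ord0)) ->
  measurable_fun setT (V : T -> coordType R u).
Proof.
move=> mV; apply: measurability => //.
move=> _ [_ [j ju [B mB <-]] <-]; rewrite setTI.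
by have := mV j ju measurableT B mB; rewrite !setTI.
Qed.

End coordinates.

Lemma measurable_preimage_rect (R : realType) (d : nat)
    (dT : measure_display) (T : measurableType dT) (V : T -> 'cV[R]_d)
    (A : 'I_d -> set R) :
  (forall j, measurable_fun setT (fun w => V w j ord0)) ->
  (forall j, measurable (A j)) -> measurable (V @^-1` rect A).
Proof.
move=> mV mA.
rewrite (_ : _ @^-1` _ = \bigcap_(j in setT) ((fun w => V w j ord0) @^-1` A j)).
  apply: fin_bigcap_measurable => // j _; rewrite -[X in measurable X]setTI.
  exact: mV.
by apply/seteqP; split => w //= h j; [move=> _|]; exact: h.
Qed.

(** Rectangles generate the sigma-algebra and are closed under intersection, so laws that agree on
    them are equal; a signed [phi] is treated through its positive and negative parts. *)
Lemma eq_law_integral (R : realType) (d : nat)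
    (d1 d2 : measure_display) (T1 : measurableType d1) (T2 : measurableType d2)
    (P1 : probability T1 R) (P2 : probability T2 R)
    (V1 : T1 -> 'cV[R]_d) (V2 : T2 -> 'cV[R]_d) :
  (forall j, measurable_fun setT (fun w => V1 w j ord0)) ->
  (forall j, measurable_fun setT (fun w => V2 w j ord0)) ->
  (forall A : 'I_d -> set R, (forall j, measurable (A j)) ->
    P1 (V1 @^-1` rect A) = P2 (V2 @^-1` rect A)) ->
  forall phi : vecType R d -> \bar R, measurable_fun setT phi ->
    (\int[P1]_w phi (V1 w) = \int[P2]_w phi (V2 w))%E.
Proof.
move=> mV1 mV2 V12 phi mphi.
set E := vecType R d.
have mV1' : measurable_fun setT (V1 : T1 -> E) by exact: measurable_to_coord.
have mV2' : measurable_fun setT (V2 : T2 -> E) by exact: measurable_to_coord.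
pose W1 : {mfun T1 >-> E} := mfun_Sub (mem_set mV1' : V1 \in @mfun _ _ T1 E).
pose W2 : {mfun T2 >-> E} := mfun_Sub (mem_set mV2' : V2 \in @mfun _ _ T2 E).
pose G : set (set E) := [set B | exists2 A : 'I_d -> set R,
  (forall j, measurable (A j)) & B = rect A].
have Gm : G `<=` measurable.
  move=> _ [A mA ->]; rewrite -[rect A]/(id @^-1` rect A).
  apply: measurable_preimage_rect => // j.
  by apply: measurable_coord; rewrite inE.
have law B : measurable B -> distribution P1 W1 B = distribution P2 W2 B.
  move=> mB.
  apply: (g_sigma_algebra_measure_unique G Gm (fun=> setT) _ _
    (distribution P1 W1) (distribution P2 W2)) => //.
  - move=> _; exists (fun=> setT) => //.
    by apply/seteqP; split.
  - by rewrite bigcup_const.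
  - move=> _ _ [A mA ->] [B' mB' ->].
    exists (fun j => A j `&` B' j); first by move=> j; exact: measurableI.
    apply/seteqP; split => [x [h h'] j //|x h].
    by split=> j; case: (h j).
  - by move=> _ [A mA ->]; exact: V12.
  - by move=> _; rewrite [X in (X < _)%E]probability_setT ltry.
  move: B mB; apply: sub_smallest2r => // B [j _ [A mA <-]].
  exists (fun k => if k == j then A else setT).
    by move=> k; case: ifP.
  apply/seteqP; split => x /=.
    by move=> [_ Ax] k; case: eqP => [->|].
  by move=> h; split => //; have := h j; rewrite eqxx.
have ge0 (psi : E -> \bar R) : measurable_fun setT psi ->
    (forall x, 0 <= psi x)%E ->
    (\int[P1]_w psi (V1 w) = \int[P2]_w psi (V2 w))%E.
  move=> mpsi psi0.
  rewrite -[LHS](ge0_integral_distribution W1) //.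
  rewrite -[RHS](ge0_integral_distribution W2) //.
  by apply: eq_measure_integral => B mB _; exact: law.
rewrite integralE [RHS]integralE; congr (_ - _)%E.
- have := ge0 _ (measurable_funepos mphi) (fun x => funepos_ge0 phi x).
  by rewrite !funepos.unlock.
- have := ge0 _ (measurable_funeneg mphi) (fun x => funeneg_ge0 phi x).
  by rewrite !funeneg.unlock.
Qed.

(** * Lipschitz functions for the l1 distance *)

Definition dist1 (R : realType) (d : nat) (x y : 'cV[R]_d) : R :=
  \sum_j `|x j ord0 - y j ord0|.

Definition lipschitz1 (R : realType) (d : nat) (phi : 'cV[R]_d -> R) : Prop :=
  exists2 K, 0 <= K & forall x y, `|phi x - phi y| <= K * dist1 x y.

Lemma norm_mul_le_sqr (R : realType) (a b : R) : `|a * b| <= a ^+ 2 + b ^+ 2.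
Proof.
rewrite normrM -(real_normK (num_real a)) -(real_normK (num_real b)).
have := sqr_ge0 (`|a| - `|b|); have := mulr_ge0 (normr_ge0 a) (normr_ge0 b).
by rewrite sqrrB; lra.
Qed.

Section lipschitz1_theory.
Context (R : realType) (d : nat).
Implicit Types (u : {set 'I_d}) (x y z : 'cV[R]_d) (phi psi : 'cV[R]_d -> R).

Lemma dist1_ge0 x y : 0 <= dist1 x y.
Proof. exact: sumr_ge0. Qed.

Lemma dist1_mixl u x y z : dist1 (mix u x z) (mix u y z) <= dist1 x y.
Proof.
by apply: ler_sum => j _; rewrite !mixE; case: ifP => // _; rewrite subrr normr0.
Qed.

Lemma dist1_mixr u x y z : dist1 (mix u z x) (mix u z y) <= dist1 x y.
Proof.
by apply: ler_sum => j _; rewrite !mixE; case: ifP => // _; rewrite subrr normr0.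
Qed.

Lemma lipschitz1_cst (c : R) : lipschitz1 (fun _ : 'cV[R]_d => c).
Proof. by exists 0 => // x y; rewrite subrr normr0 mul0r. Qed.

Lemma lipschitz1N phi : lipschitz1 phi -> lipschitz1 (fun x => - phi x).
Proof.
by move=> [K K0 h]; exists K => // x y; rewrite -opprD normrN; exact: h.
Qed.

Lemma lipschitz1D phi psi : lipschitz1 phi -> lipschitz1 psi ->
  lipschitz1 (fun x => phi x + psi x).
Proof.
move=> [K K0 hK] [L L0 hL]; exists (K + L) => [|x y]; first exact: addr_ge0.
by rewrite opprD addrACA mulrDl (le_trans (ler_normD _ _))// lerD.
Qed.

Lemma lipschitz1B phi psi : lipschitz1 phi -> lipschitz1 psi ->
  lipschitz1 (fun x => phi x - psi x).
Proof. by move=> hphi /lipschitz1N hpsi; exact: lipschitz1D. Qed.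

Lemma lipschitz1_sum (I : Type) (s : seq I) (Q : pred I)
    (F : I -> 'cV[R]_d -> R) : (forall i, Q i -> lipschitz1 (F i)) ->
  lipschitz1 (fun x => \sum_(i <- s | Q i) F i x).
Proof.
move=> hF; elim: s => [|i s IH].
  rewrite [X in lipschitz1 X](_ : _ = fun=> 0); first exact: lipschitz1_cst.
  by apply/funext => x; rewrite big_nil.
rewrite [X in lipschitz1 X](_ : _ = fun x => (if Q i then F i x else 0) +
    \sum_(j <- s | Q j) F j x); last first.
  by apply/funext => x; rewrite big_cons; case: ifP; rewrite ?add0r.
apply: lipschitz1D => //; case Qi: (Q i); [exact: hF|exact: lipschitz1_cst].
Qed.

Lemma lipschitz1_mixl u z phi : lipschitz1 phi ->
  lipschitz1 (fun x => phi (mix u x z)).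
Proof.
move=> [K K0 h]; exists K => // x y; apply: le_trans (h _ _) _.
by rewrite ler_wpM2l// dist1_mixl.
Qed.

Lemma lipschitz1_mixr u z phi : lipschitz1 phi ->
  lipschitz1 (fun x => phi (mix u z x)).
Proof.
move=> [K K0 h]; exists K => // x y; apply: le_trans (h _ _) _.
by rewrite ler_wpM2l// dist1_mixr.
Qed.

(* McShane: [phi] is the infimum over rational points [q] of
   [phi q + K * dist1 x q]. *)
Lemma measurable_lipschitz1 u phi : lipschitz1 phi -> depends_on u phi ->
  measurable_fun [set: coordType R u] phi.
Proof.
move=> [K K0 hK] uphi.
apply: (measurability _ (RGenInftyO.measurableE R)) => _ [_ [a ->] <-].
pose q (p : 'cV[rat]_d) : 'cV[R]_d := map_mx ratr p.
(* Both points are masked outside [u], so that [D p] is measurable for the coordinates in [u]. *)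
pose D (p : 'cV[rat]_d) (x : 'cV[R]_d) := dist1 (mix u x 0) (mix u (q p) 0).
have hD p x : `|phi x - phi (q p)| <= K * D p x.
  by rewrite -(uphi x 0) -(uphi (q p) 0).
rewrite setTI (_ : _ @^-1` _ =
    \bigcup_(p : 'cV[rat]_d) [set x | phi (q p) + K * D p x < a]); last first.
  apply/seteqP; split => [x|x [p _]] /=; rewrite ?in_itv /=; last first.
    by have := hD p x; rewrite ler_norml => /andP[_ h1] h2; lra.
  (* When [D p x <= e * d], the value at [p] is at most [phi x + 2 * K * e * d], which this [e]
     keeps below [a]; the [+ 1] makes the denominator positive even if [K] or [d] is 0. *)
  move=> xa; pose e := (a - phi x) / (2 * K * d%:R + 1).
  have den0 : 0 < 2 * K * d%:R + 1 :> R.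
    by rewrite ltr_wpDl// !mulr_ge0.
  have e0 : 0 < e by rewrite divr_gt0// subr_gt0.
  have hr (j : 'I_d) : exists r : rat, `|x j ord0 - ratr r| < e.
    have [|r] := @rat_in_itvoo R (x j ord0 - e) (x j ord0 + e); first lra.
    by rewrite in_itv /= => /andP[h1 h2]; exists r; rewrite ltr_norml; lra.
  have [r hr'] := choice hr.
  exists (\col_j r j) => //=; set p := \col_j r j.
  have De : D p x <= e * d%:R.
    rewrite -[d in d%:R]card_ord mulr_natr -sumr_const; apply: ler_sum => j _.
    rewrite !mixE; case: ifP => _; last by rewrite subrr normr0 ltW.
    by rewrite !mxE; exact/ltW/hr'.
  have KD : K * D p x <= K * (e * d%:R) by rewrite ler_wpM2l.
  have : e * (2 * K * d%:R + 1) = a - phi x by rewrite divfK// gt_eqF.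
  by have := hD p x; rewrite ler_norml => /andP[h1 _] h2; lra.
apply: countable_bigcupT_measurable => [|p]; first exact: countableP.
have mD : measurable_fun [set: coordType R u] (fun x => phi (q p) + K * D p x).
  apply: measurable_funD => //; apply: measurable_funM => //.
  apply: measurable_sum => j; apply: measurableT_comp => //.
  apply: measurable_funB => //.
  under eq_fun do rewrite mixE.
  by case ju: (j \in u); [exact: measurable_coord|exact: measurable_cst].
have := mD measurableT `]-oo, a[%classic (measurable_itv _).
by rewrite setTI.
Qed.

(** Supplies an integrable majorant: finite second moments of the coordinates make every function of
    the class square-integrable. *)
Lemma lipschitz1_sqr_le phi : lipschitz1 phi ->
  exists c, forall x, phi x ^+ 2 <= c * (1 + \sum_j x j ord0 ^+ 2).
Proof.
move=> [K K0 h].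
pose S x : R := \sum_j `|x j ord0|.
have S2 x : S x ^+ 2 <= 2 * d%:R * \sum_j x j ord0 ^+ 2.
  rewrite expr2 /S mulr_suml.
  have : \sum_(i < d) `|x i ord0| * \sum_j `|x j ord0| <=
      \sum_(i < d) \sum_(j < d) (x i ord0 ^+ 2 + x j ord0 ^+ 2).
    apply: ler_sum => i _; rewrite mulr_sumr; apply: ler_sum => j _.
    by rewrite -normrM norm_mul_le_sqr.
  move=> /le_trans; apply.
  under eq_bigr do rewrite big_split /= sumr_const card_ord.
  rewrite big_split /= sumr_const card_ord sumrMnl -mulr_natr.
  by lra.
(* From [phi x ^+ 2 <= 2 * phi 0 ^+ 2 + 2 * (phi x - phi 0) ^+ 2] and the bound [S2], whose factor 2
   turns the second 2 into 4. *)
exists (2 * phi 0 ^+ 2 + 4 * K ^+ 2 * d%:R) => x.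
have hx : `|phi x - phi 0| <= K * S x.
  apply: le_trans (h _ _) _; rewrite ler_wpM2l// le_eqVlt; apply/orP; left.
  by apply/eqP/eq_bigr => j _; rewrite mxE subr0.
have S0 : 0 <= S x by exact: sumr_ge0.
have hx2 : (phi x - phi 0) ^+ 2 <= K ^+ 2 * S x ^+ 2.
  rewrite -exprMn -(real_normK (num_real (phi x - phi 0))) ler_sqr//.
  by rewrite nnegrE mulr_ge0.
have KS : K ^+ 2 * S x ^+ 2 <= K ^+ 2 * (2 * d%:R * \sum_j x j ord0 ^+ 2).
  by rewrite ler_wpM2l// sqr_ge0.
have N0 : 0 <= \sum_j x j ord0 ^+ 2 by apply: sumr_ge0 => j _; exact: sqr_ge0.
have M0 : 0 <= K ^+ 2 * d%:R by rewrite mulr_ge0// sqr_ge0.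
have pN0 : 0 <= phi 0 ^+ 2 * \sum_j x j ord0 ^+ 2 by rewrite mulr_ge0// sqr_ge0.
have split : phi x ^+ 2 = 2 * phi 0 ^+ 2 + 2 * (phi x - phi 0) ^+ 2
    - (phi x - 2 * phi 0) ^+ 2 by ring.
have := sqr_ge0 (phi x - 2 * phi 0).
move: KS N0 M0 pN0; set N := \sum_j _.
rewrite (_ : K ^+ 2 * (2 * d%:R * N) = 2 * (K ^+ 2 * d%:R * N)); last by ring.
rewrite split (_ : _ * (1 + N) = 2 * phi 0 ^+ 2 + 2 * (phi 0 ^+ 2 * N)
  + 4 * (K ^+ 2 * d%:R) + 4 * (K ^+ 2 * d%:R * N)); last by ring.
by move=> *; lra.
Qed.

End lipschitz1_theory.

(** * Averaging over independent coordinates *)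

Lemma Rintegral_prob_cst (disp : measure_display) (T : measurableType disp)
  (R : realType) (P : probability T R) (c : R) : \int[P]_w c = c.
Proof. by rewrite Rintegral_cst// [X in fine X]probability_setT mulr1. Qed.

Section independent_coordinates.
Context (disp : measure_display) (T : measurableType disp) (R : realType)
  (P : probability T R) (d : nat) (V : T -> 'cV[R]_d).
Context
  (mV : forall j, measurable_fun setT (fun w => V w j ord0))
  (indV : forall A : 'I_d -> set R, (forall j, measurable (A j)) ->
    (P (V @^-1` rect A)
     = \prod_j P ((fun w => V w j ord0) @^-1` A j))%E)
  (sqV : forall j, P.-integrable setT (fun w => (V w j ord0 ^+ 2)%:E)).
Implicit Types (u v : {set 'I_d}) (x y : 'cV[R]_d) (phi psi : 'cV[R]_d -> R).

Let mVE : measurable_fun setT (V : T -> vecType R d).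
Proof. exact: measurable_to_coord. Qed.

Lemma measurable_mixV u j :
  measurable_fun setT (fun p : T * T => mix u (V p.1) (V p.2) j ord0).
Proof.
under eq_fun do rewrite mixE.
by case: (j \in u); exact: (measurableT_comp (mV j)).
Qed.

(** Both laws factor over the coordinates, since each coordinate comes from exactly one of the two
    independent copies. The coordinates outside [u] can thus be resampled, which is the form in
    which Fubini is applied below. *)
Lemma law_mix u (phi : vecType R d -> \bar R) : measurable_fun setT phi ->
  (\int[P \x P]_p phi (mix u (V p.1) (V p.2)) = \int[P]_w phi (V w))%E.
Proof.
apply: (eq_law_integral (measurable_mixV u) mV) => A mA.
(* The rectangle splits into constraints on the first copy and on the second, each padded with the
   whole line. *)
pose Au j := if j \in u then A j else setT.
pose Ac j := if j \in u then setT else A j.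
have mAu j : measurable (Au j) by rewrite /Au; case: ifP.
have mAc j : measurable (Ac j) by rewrite /Ac; case: ifP.
rewrite (_ : _ @^-1` _ = (V @^-1` rect Au) `*` (V @^-1` rect Ac)); last first.
  apply/seteqP; split => [p /= h|p [/= h1 h2] j].
    by split => j /=; rewrite /Au /Ac; have := h j; rewrite mixE; case: ifP.
  by move: (h1 j) (h2 j); rewrite /Au /Ac mixE; case: ifP.
rewrite [LHS]product_measure1E//; try exact: measurable_preimage_rect.
transitivity ((\prod_j P ((fun w => V w j ord0) @^-1` Au j)) *
    \prod_j P ((fun w => V w j ord0) @^-1` Ac j))%E.
  by congr (_ * _)%E; exact: indV.
rewrite indV// -big_split /=; apply: eq_bigr => j _.
rewrite /Au /Ac; case: ifP => _; rewrite preimage_setT probability_setT.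
  by rewrite mule1.
by rewrite mul1e.
Qed.

Lemma measurable_lipschitz1V phi : lipschitz1 phi ->
  measurable_fun setT (phi \o V).
Proof.
move=> hphi; apply: (measurableT_comp _ mVE).
by apply: measurable_lipschitz1 => // x y; rewrite mixT.
Qed.

(** The product is dominated by [phi ^+ 2 + psi ^+ 2], hence by a multiple of 1 plus the sum of the
    squared coordinates. *)
Lemma integrable_lipschitz1M phi psi : lipschitz1 phi -> lipschitz1 psi ->
  P.-integrable setT (EFin \o (fun w => phi (V w) * psi (V w))).
Proof.
move=> hphi hpsi.
have [c hc] := lipschitz1_sqr_le hphi; have [c' hc'] := lipschitz1_sqr_le hpsi.
pose W w : R := (c + c') * (1 + \sum_j V w j ord0 ^+ 2).
apply: (@le_integrable _ _ _ _ _ _ _ (EFin \o W)) => //.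
- apply/measurable_EFinP; apply: measurable_funM;
    exact: measurable_lipschitz1V.
- move=> w _ /=; rewrite lee_fin; apply: le_trans (norm_mul_le_sqr _ _) _.
  by rewrite (le_trans _ (ler_norm _))// /W mulrDl lerD.
- rewrite /W; under [X in integrable _ _ X]funext do rewrite /= EFinM.
  apply: integrableZl => //.
  under [X in integrable _ _ X]funext do rewrite EFinD -sumEFin.
  apply: integrableD => //; first exact: finite_measure_integrable_cst.
  exact: integrable_sum.
Qed.

Lemma integrable_lipschitz1 phi : lipschitz1 phi ->
  P.-integrable setT (EFin \o (fun w => phi (V w))).
Proof.
move=> hphi; have := integrable_lipschitz1M hphi (lipschitz1_cst d 1).
by apply: eq_integrable => // w _ /=; rewrite mulr1.
Qed.

(* By independence this is a version of [E(phi(x) | x_u)], defined everywhere. *)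
Definition average u phi x : R := \int[P]_w phi (mix u x (V w)).

Lemma average_depends u phi : depends_on u (average u phi).
Proof.
by move=> x y; apply: eq_Rintegral => w _; rewrite mix_mixl.
Qed.

(** The Lipschitz constant is inherited because [mix] is nonexpansive in its first argument; this
    keeps the ANOVA recursion inside the class. *)
Lemma average_lipschitz1 u phi : lipschitz1 phi -> lipschitz1 (average u phi).
Proof.
move=> hphi; have [K K0 hK] := hphi; exists K => // x y.
have int z := integrable_lipschitz1 (lipschitz1_mixr u z hphi).
rewrite /average -RintegralB//.
have intB := integrable_lipschitz1 (lipschitz1B (lipschitz1_mixr u x hphi)
  (lipschitz1_mixr u y hphi)).
apply: le_trans (le_normr_Rintegral _ intB) _ => //.
rewrite -[leRHS](Rintegral_prob_cst P).
apply: le_Rintegral => //.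
- exact: integrable_norm.
- exact: finite_measure_integrable_cst.
- move=> w _; apply: le_trans (hK _ _) _.
  by rewrite ler_wpM2l// dist1_mixl.
Qed.

Lemma average_id u phi : depends_on u phi -> average u phi = phi.
Proof.
move=> uphi; apply/funext => x; rewrite /average.
under eq_Rintegral do rewrite uphi.
exact: Rintegral_prob_cst.
Qed.

(** After resampling by [law_mix], [psi] sees only the first copy and leaves the inner integral,
    which is then the average. [psi] ranges over measurable functions so that indicators of events
    are included, as conditional expectations require. *)
Lemma Rintegral_averageM u phi (psi : vecType R d -> R) :
  lipschitz1 phi -> measurable_fun setT psi -> depends_on u psi ->
  P.-integrable setT (EFin \o (fun w => psi (V w) * phi (V w))) ->
  (\int[P]_w (psi (V w) * average u phi (V w))%:E
   = \int[P]_w (psi (V w) * phi (V w))%:E)%E.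
Proof.
move=> hphi mpsi upsi ipsi.
have mphi : measurable_fun [set: vecType R d] phi.
  by apply: measurable_lipschitz1 => // x y; rewrite mixT.
pose h (p : T * T) := (psi (mix u (V p.1) (V p.2)) *
  phi (mix u (V p.1) (V p.2)))%:E.
have mh : measurable_fun [set: vecType R d] (fun x => psi x * phi x).
  exact: measurable_funM.
have ih : (P \x P)%E.-integrable setT h.
  apply/integrableP; split.
    apply/measurable_EFinP.
    apply: (measurableT_comp (T2 := vecType R d) mh).
    by apply: measurable_to_coord => j _; exact: measurable_mixV.
  rewrite (law_mix u (phi := fun x => `|(psi x * phi x)%:E|%E)).
    by have /integrableP[] := ipsi.
  exact/measurableT_comp/measurable_EFinP.
rewrite -(law_mix u (phi := fun x => (psi x * phi x)%:E)); last first.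
  exact/measurable_EFinP.
rewrite -(integral12_prod_meas1 ih); apply: eq_integral => w _.
rewrite /fubini_F /h /=; under [RHS]eq_integral do rewrite upsi EFinM.
rewrite integralZl//; last first.
  exact: integrable_lipschitz1 (lipschitz1_mixr _ _ hphi).
rewrite EFinM; congr (_ * _)%E; rewrite /average /Rintegral fineK//.
apply: integrable_fin_num => //.
exact: integrable_lipschitz1 (lipschitz1_mixr u (V w) hphi).
Qed.

(** With the coordinates in [u :&: v] frozen at [x], the two sides are the expectations of
    [average v chi] and of [chi], which agree by [Rintegral_averageM] with [psi] equal to 1. *)
Lemma average_average u v phi : lipschitz1 phi ->
  average u (average v phi) = average (u :&: v)%SET phi.
Proof.
move=> hphi; apply/funext => x.
have hchi := lipschitz1_mixr (u :&: v)%SET x hphi.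
set chi := (fun y => phi _) in hchi.
have chiE y : average v phi (mix u x y) = average v chi y.
  by apply: eq_Rintegral => w _; rewrite mix_mix.
have := Rintegral_averageM (u := v) hchi (measurable_cst (1 : R)) _ _.
rewrite /average /Rintegral => h; congr fine.
under eq_integral do rewrite [X in X%:E]chiE -[X in X%:E]mul1r.
rewrite h//; first by apply: eq_integral => w _; rewrite mul1r.
have := integrable_lipschitz1 hchi.
by apply: eq_integrable => // w _ /=; rewrite mul1r.
Qed.

Lemma Rintegral_sum (I : Type) (s : seq I) (Q : pred I) (F : I -> T -> R) :
  (forall i, P.-integrable setT (EFin \o F i)) ->
  \int[P]_w (\sum_(i <- s | Q i) F i w) = \sum_(i <- s | Q i) \int[P]_w F i w.
Proof.
move=> iF; rewrite /Rintegral sum_fine; last first.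
  by move=> i _; apply: integrable_fin_num => //; exact: iF.
congr fine; rewrite -integral_sum//.
by apply: eq_integral => w _; rewrite sumEFin.
Qed.

Lemma average_sum (I : Type) (s : seq I) (Q : pred I)
    (F : I -> 'cV[R]_d -> R) u x : (forall i, lipschitz1 (F i)) ->
  average u (fun y => \sum_(i <- s | Q i) F i y) x
  = \sum_(i <- s | Q i) average u (F i) x.
Proof.
move=> hF; apply: Rintegral_sum => i.
exact: integrable_lipschitz1 (lipschitz1_mixr u x (hF i)).
Qed.

Lemma averageB u phi psi x : lipschitz1 phi -> lipschitz1 psi ->
  average u (fun y => phi y - psi y) x = average u phi x - average u psi x.
Proof.
move=> hphi hpsi; rewrite /average RintegralB//.
- exact: integrable_lipschitz1 (lipschitz1_mixr u x hphi).
- exact: integrable_lipschitz1 (lipschitz1_mixr u x hpsi).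
Qed.

Definition inner phi psi : R := \int[P]_w (phi (V w) * psi (V w)).

Lemma innerC phi psi : inner phi psi = inner psi phi.
Proof. by apply: eq_Rintegral => w _; rewrite mulrC. Qed.

Lemma inner_ge0 phi : 0 <= inner phi phi.
Proof. by apply: Rintegral_ge0 => w _; rewrite -expr2 sqr_ge0. Qed.

Lemma inner_suml (I : Type) (s : seq I) (Q : pred I)
    (F : I -> 'cV[R]_d -> R) psi :
  (forall i, lipschitz1 (F i)) -> lipschitz1 psi ->
  inner (fun y => \sum_(i <- s | Q i) F i y) psi
  = \sum_(i <- s | Q i) inner (F i) psi.
Proof.
move=> hF hpsi; rewrite -Rintegral_sum.
  by apply: eq_Rintegral => w _; rewrite mulr_suml.
by move=> i; exact: integrable_lipschitz1M (hF i) hpsi.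
Qed.

Lemma innerBl phi psi chi :
  lipschitz1 phi -> lipschitz1 psi -> lipschitz1 chi ->
  inner (fun y => phi y - psi y) chi = inner phi chi - inner psi chi.
Proof.
move=> hphi hpsi hchi; rewrite /inner -RintegralB//.
- by apply: eq_Rintegral => w _; rewrite mulrBl.
- exact: integrable_lipschitz1M hphi hchi.
- exact: integrable_lipschitz1M hpsi hchi.
Qed.

Lemma inner_subr_sqr phi psi : lipschitz1 phi -> lipschitz1 psi ->
  inner (fun y => phi y - psi y) (fun y => phi y - psi y)
  = inner phi phi - 2 * inner phi psi + inner psi psi.
Proof.
move=> hphi hpsi; have hB := lipschitz1B hphi hpsi.
rewrite (innerBl hphi hpsi hB) (innerC phi) (innerC psi).
rewrite (innerBl hphi hpsi hphi) (innerBl hphi hpsi hpsi) (innerC psi phi).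
by ring.
Qed.

Lemma inner_average u phi psi : lipschitz1 phi -> lipschitz1 psi ->
  depends_on u psi -> inner psi (average u phi) = inner psi phi.
Proof.
move=> hphi hpsi upsi; congr fine; apply: Rintegral_averageM => //.
  by apply: measurable_lipschitz1 => // x y; rewrite mixT.
exact: integrable_lipschitz1M hpsi hphi.
Qed.

(** Both sides equal the inner product of the two averages. *)
Lemma inner_average_sym u phi psi : lipschitz1 phi -> lipschitz1 psi ->
  inner (average u phi) psi = inner phi (average u psi).
Proof.
move=> hphi hpsi.
have hA := average_lipschitz1 u hphi; have hB := average_lipschitz1 u hpsi.
rewrite -(inner_average hpsi hA (average_depends u phi)) innerC.
by rewrite (inner_average hphi hB (average_depends u psi)) innerC.
Qed.

Lemma variance_lipschitz1 phi : lipschitz1 phi ->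
  ('V_P[phi \o V] = (inner phi phi - (\int[P]_w phi (V w)) ^+ 2)%:E)%E.
Proof.
move=> hphi.
have i1 := integrable_lipschitz1 hphi.
have i2 := integrable_lipschitz1M hphi hphi.
rewrite /variance covarianceE; [|exact/Lfun1_integrable..].
rewrite unlock EFinB EFin_expe expe2 /Rintegral /inner.
by rewrite !fineK//; apply: integrable_fin_num.
Qed.

(** * The ANOVA decomposition *)

Section anova_decomposition.
Context (f : 'cV[R]_d -> R) (hf : lipschitz1 f).

(** A copy of [anova_rec] with the everywhere defined [average] in place of the chosen conditional
    expectation; [anova_rec_component] identifies the two almost everywhere. *)
Fixpoint component_rec (n : nat) u x : R :=
  if n is m.+1 then
    average u f x - \sum_(v : {set 'I_d} | v \proper u) component_rec m v x
  else 0.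

Definition component u := component_rec #|u|.+1 u.

Lemma component_rec_stable n m u x : (#|u| < n)%N -> (#|u| < m)%N ->
  component_rec n u x = component_rec m u x.
Proof.
elim: n m u => [//|n IH] [//|m] u un um /=.
congr (_ - _); apply: eq_bigr => v vu.
by apply: IH; rewrite (leq_trans (proper_card vu)).
Qed.

Lemma componentE u x :
  component u x
  = average u f x - \sum_(v : {set 'I_d} | v \proper u) component v x.
Proof.
rewrite {1}/component /=; congr (_ - _); apply: eq_bigr => v vu.
by apply: component_rec_stable; rewrite ?proper_card.
Qed.

Lemma sum_component u x :
  \sum_(v : {set 'I_d} | v \subset u) component v x = average u f x.
Proof.
rewrite (bigD1 u)//= componentE -addrA [X in _ + X](_ : _ = 0) ?addr0//.
apply/eqP; rewrite addrC subr_eq0; apply/eqP/eq_bigl => v.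
by rewrite finset.properEneq andbC.
Qed.

Lemma component_ind (Q : {set 'I_d} -> Prop) :
  (forall u, (forall v, v \proper u -> Q v) -> Q u) -> forall u, Q u.
Proof.
move=> H u; have [n] := ubnP #|u|; elim: n u => // n IH u un.
by apply: H => v /proper_card vu; apply: IH; exact: leq_trans vu _.
Qed.

Lemma lipschitz1_component_rec n u : lipschitz1 (component_rec n u).
Proof.
elim: n u => [|n IH] u /=; first exact: lipschitz1_cst.
apply: lipschitz1B; first exact: average_lipschitz1.
by apply: lipschitz1_sum.
Qed.

Lemma lipschitz1_component u : lipschitz1 (component u).
Proof. exact: lipschitz1_component_rec. Qed.

Lemma component_depends u : depends_on u (component u).
Proof.
elim/component_ind: u => u IH x y; rewrite !componentE average_depends.
congr (_ - _); apply: eq_bigr => v vu.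
exact: (depends_onW (proper_sub vu) (IH v vu)).
Qed.

Lemma average_component u (t : {set 'I_d}) : u \subset t ->
  average t (component u) = component u.
Proof.
by move=> ut; apply: average_id; exact: depends_onW ut (@component_depends u).
Qed.

(** Applying [average t] to the recursion turns [average u f] into the sum of the components below
    [u :&: t]. Among the subtracted terms, those not below [t] vanish by induction and the others
    are fixed. As [u] is not below [t], the fixed ones are exactly the components below [u :&: t],
    and everything cancels. *)
Lemma average_component_eq0 u (t : {set 'I_d}) x : ~~ (u \subset t) ->
  average t (component u) x = 0.
Proof.
elim/component_ind: u => u IH ut.
rewrite (_ : component u = fun y => average u f y
    - \sum_(v : {set 'I_d} | v \proper u) component v y); last first.
  by apply/funext => y; exact: componentE.
rewrite averageB; [|exact: average_lipschitz1|]; last first.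
  by apply: lipschitz1_sum => v _; exact: lipschitz1_component.
rewrite average_average// average_sum; last exact: lipschitz1_component.
rewrite -sum_component.
rewrite [X in _ - X](bigID (fun v : {set 'I_d} => v \subset t)) /=.
rewrite [X in _ - (_ + X)]big1 ?addr0; last by move=> v /andP[vu vt]; exact: IH.
apply/eqP; rewrite subr_eq0; apply/eqP; apply: eq_big => [v|v vtu].
  rewrite finset.subsetI andbC.
  case vt: (v \subset t); rewrite ?andbF//= !andbT.
  rewrite properE; case: (v \subset u) => //=; symmetry.
  by apply: contraNN ut => /fintype.subset_trans; exact.
by rewrite average_component//; move: vtu; rewrite finset.subsetI => /andP[].
Qed.

(** If [s] is not contained in [t], the component at [t] is fixed by [average t], which can be moved
    to the component at [s] and kills it. For [u != v] one of the two inclusions fails. *)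
Lemma inner_component_eq0 u v : u != v -> inner (component u) (component v) = 0.
Proof.
have H (s t : {set 'I_d}) : ~~ (s \subset t) ->
    inner (component s) (component t) = 0.
  move=> st; rewrite -(average_component (subxx t)) -inner_average_sym;
    [|exact: lipschitz1_component..].
  rewrite /inner; under eq_Rintegral do rewrite average_component_eq0// mul0r.
  exact: Rintegral_prob_cst.
rewrite finset.eqEsubset negb_and => /orP[/H//|/H]; by rewrite innerC.
Qed.

Lemma inner_average_component u :
  inner (average u f) (average u f)
  = \sum_(v : {set 'I_d} | v \subset u) inner (component v) (component v).
Proof.
have lc := lipschitz1_component.
have -> : average u f = fun y =>
    \sum_(v : {set 'I_d} | v \subset u) component v y.
  by apply/funext => y; rewrite sum_component.
rewrite inner_suml//; last by apply: lipschitz1_sum.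
apply: eq_bigr => v vu; rewrite innerC inner_suml// (bigD1 v)//= big1 ?addr0//.
by move=> s /andP[_ sv]; exact: inner_component_eq0.
Qed.

(* [average u f] is the orthogonal projection of [f] onto the functions of the
   coordinates in [u], so no such [h] is closer to [f]. *)
Lemma inner_sub_average_le u h : lipschitz1 h -> depends_on u h ->
  inner f f - inner (average u f) (average u f)
  <= inner (fun x => f x - h x) (fun x => f x - h x).
Proof.
move=> hh uh; set A := average u f.
have hA : lipschitz1 A by exact: average_lipschitz1.
have fh : inner f h = inner A h.
  by rewrite innerC -(inner_average hf hh uh) innerC.
have := inner_ge0 (fun x => A x - h x).
by rewrite (inner_subr_sqr hf hh) (inner_subr_sqr hA hh) fh; lra.
Qed.

End anova_decomposition.
End independent_coordinates.

(** * Conditional expectations *)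

(** For rational [r] the event [Z' <= r < Z] belongs to [G], so [Z - Z'] has integral 0 over it
    although it is positive there; hence the event is null. Countably many such events and their
    mirror images cover [Z != Z']. *)
Lemma is_cond_exp_ae_unique (disp : measure_display) (T : measurableType disp)
    (R : realType) (P : probability T R) (G : set (set T)) (Y Z Z' : T -> R) :
  G `<=` measurable -> setI_closed G ->
  is_cond_exp P G Y Z -> is_cond_exp P G Y Z' ->
  {ae P, forall w, Z w = Z' w}.
Proof.
move=> Gm GI.
have half (U W : T -> R) (r : rat) :
    is_cond_exp P G Y U -> is_cond_exp P G Y W ->
    P.-negligible (U @^-1` `]ratr r, +oo[ `&` W @^-1` `]-oo, ratr r]).
  move=> [GU iU EU] [GW iW EW]; set A := _ `&` _.
  have GA : G A.
    apply: GI; [apply: GU|apply: GW].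
      by exists `]ratr r, +oo[%classic; rewrite ?setTI.
    by exists `]-oo, ratr r]%classic; rewrite ?setTI.
  have mA := Gm _ GA.
  have iUA : P.-integrable A (EFin \o U) by exact: integrableS iU.
  have iWA : P.-integrable A (EFin \o W) by exact: integrableS iW.
  have AUW w : A w -> 0 < U w - W w.
    by move=> []; rewrite /= !in_itv /= andbT => h1 h2; lra.
  have iUW := integrableB mA iUA iWA.
  have : (\int[P]_(w in A) `|(U w)%:E - (W w)%:E| = 0)%E.
    under eq_integral => w /[!inE] /AUW UW.
      rewrite gee0_abs; last by rewrite lee_fin ltW.
      over.
    rewrite integralB// EU// -EW// subee//.
    by apply: integrable_fin_num => //; exact: iWA.
  move=> /(ae_eq_integral_abs P mA (measurable_int _ iUW)).
  move=> [N [mN PN AN]]; exists N; split => // w Aw; apply: AN => /= h.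
  by have := AUW w Aw; have [->] := h Aw; rewrite ltxx.
move=> hZ hZ'.
pose N (r : rat) := (Z @^-1` `]ratr r, +oo[ `&` Z' @^-1` `]-oo, ratr r])
  `|` (Z' @^-1` `]ratr r, +oo[ `&` Z @^-1` `]-oo, ratr r]).
(* Lists the events indexed by rationals as a sequence over [nat]. *)
pose F k := if unpickle k is Some r then N r else set0.
apply: (@negligibleS _ _ _ _ (\bigcup_k F k)); last first.
  apply: negligible_bigcup => k; rewrite /F.
  by case: unpickle => [r|]; [apply: negligibleU; exact: half|
    exact: negligible_set0].
have NF r w : N r w -> (\bigcup_k F k) w.
  by move=> Nw; exists (pickle r); [|rewrite /F pickleK].
move=> w /eqP; rewrite neq_lt => /orP[] /rat_in_itvoo[r];
  rewrite in_itv => /andP[h1 h2]; apply: (NF r); [right|left];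
  by split; rewrite /= in_itv /= ?andbT ?(ltW h1).
Qed.

Section conditional_expectations.
Context (disp : measure_display) (T : measurableType disp) (R : realType)
  (P : probability T R) (d : nat) (X : 'I_d -> {RV P >-> R}).
Local Notation V := (random_vector X).
Context
  (indV : forall A : 'I_d -> set R, (forall j, measurable (A j)) ->
    (P (V @^-1` rect A)
     = \prod_j P ((fun w => V w j ord0) @^-1` A j))%E)
  (sqV : forall j, P.-integrable setT (fun w => (V w j ord0 ^+ 2)%:E)).
Implicit Types (u v : {set 'I_d}).

Lemma measurable_random_vector j :
  measurable_fun setT (fun w => V w j ord0).
Proof. by under eq_fun do rewrite mxE; exact: measurable_funP. Qed.

Let mV := measurable_random_vector.

(** Turns the events of [sigma_coord X u] into preimages of sets [B] measurable in the coordinates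
    [u], whose indicators can serve as [psi] in [Rintegral_averageM]. *)
Lemma sigma_coordE u : sigma_coord X u =
  preimage_set_system setT V (@coord_sets R d u).-sigma.-measurable.
Proof.
rewrite -g_sigma_preimageE /sigma_coord; congr (<<s _ >>).
have VX (j : 'I_d) : (fun w => V w j ord0) = X j.
  by apply/funext => w; rewrite mxE.
apply/seteqP; split => [_ [j ju [B mB <-]]|_ [_ [j ju [B mB <-]] <-]].
- exists ((fun x : 'cV[R]_d => x j ord0) @^-1` B); last by rewrite !setTI -VX.
  by exists j => //; exists B => //; rewrite setTI.
- by exists j => //; exists B => //; rewrite !setTI -VX.
Qed.

Lemma measurable_preimageV u B : (@coord_sets R d u).-sigma.-measurable B ->
  measurable (V @^-1` B).
Proof.
move=> mB; rewrite -[X in measurable X]setTI.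
by apply: (measurable_to_coord (u := u)) => // j _; exact: mV.
Qed.

Lemma is_cond_exp_average u f : lipschitz1 f ->
  is_cond_exp P (sigma_coord X u) (f \o V) (average P V u f \o V).
Proof.
move=> hf; have hA := average_lipschitz1 mV sqV u hf; split.
- rewrite sigma_coordE => _ [B mB <-].
  exists (average P V u f @^-1` B); rewrite ?setTI//.
  rewrite -[X in measurable X]setTI.
  exact: (measurable_lipschitz1 hA (average_depends P V u f)) _ mB.
- exact: (integrable_lipschitz1 mV sqV hA).
- move=> A; rewrite sigma_coordE => -[B mB <-]; rewrite setTI.
  have mVB := measurable_preimageV mB.
  have uB := depends_on_coord mB.
  have E (g : 'cV[R]_d -> R) : (\int[P]_(w in V @^-1` B) (g (V w))%:E
      = \int[P]_w (\1_B (V w) * g (V w))%:E)%E.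
    rewrite integral_mkcond; apply: eq_integral => w _.
    rewrite patchE /= indicE; case: ifPn.
    + by move=> /set_mem h; rewrite mem_set// mul1r.
    + by move=> /negP h; rewrite memNset ?mul0r// => Bw; exact/h/mem_set.
  rewrite (E (average P V u f)) (E f).
  have mB' : measurable (B : set (vecType R d)).
    by apply: coord_sigmaS mB; exact: finset.subsetT.
  apply: (Rintegral_averageM mV indV sqV hf) => //.
  + move=> x y; rewrite !indicE (_ : (mix u x y \in B) = (x \in B))//.
    by apply/idP/idP; rewrite !inE uB.
  + apply: le_integrable (integrable_lipschitz1 mV sqV hf) => //.
    * apply/measurable_EFinP; apply: measurable_funM; last first.
        exact: (measurable_lipschitz1V mV hf).
      apply: (measurableT_comp (T2 := vecType R d)).
        exact: measurable_indic.
      exact: measurable_to_coord.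
    * move=> w _ /=; rewrite lee_fin normrM indicE.
      by case: (_ \in _); rewrite ?normr1 ?mul1r// normr0 mul0r.
Qed.

(** The average is a version, so [xget] does not fall back on its default 0. *)
Lemma cond_exp_spec u f : lipschitz1 f ->
  is_cond_exp P (sigma_coord X u) (f \o V)
    (cond_exp P (sigma_coord X u) (f \o V)).
Proof.
move=> hf; apply: (xgetPex (fun=> 0)); exists (average P V u f \o V).
exact: is_cond_exp_average.
Qed.

Lemma cond_exp_average u f : lipschitz1 f ->
  {ae P, forall w, cond_exp P (sigma_coord X u) (f \o V) w
    = average P V u f (V w)}.
Proof.
move=> hf; apply: is_cond_exp_ae_unique (cond_exp_spec u hf)
  (is_cond_exp_average u hf).
- rewrite sigma_coordE => _ [B mB <-]; rewrite setTI.
  exact: measurable_preimageV mB.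
- rewrite sigma_coordE => _ _ [B mB <-] [B' mB' <-].
  by exists (B `&` B'); [exact: measurableI|rewrite !setTI].
Qed.

Lemma measurable_anova_rec f n u : lipschitz1 f ->
  measurable_fun setT (anova_rec X f n u).
Proof.
move=> hf; elim: n u => [|n IH] u /=; first exact: measurable_cst.
apply: measurable_funB.
  by have [_ /measurable_int/measurable_EFinP] := cond_exp_spec u hf.
under eq_fun do rewrite big_mkcond /=.
by apply: measurable_sum => v; case: (v \proper u) => //; exact: measurable_cst.
Qed.

(** At each level only finitely many subsets occur, so their exceptional null sets can be discarded
    together. *)
Lemma anova_rec_component f n u : lipschitz1 f ->
  {ae P, forall w, anova_rec X f n u w = component_rec P V f n u (V w)}.
Proof.
move=> hf; elim: n u => [|n IH] u /=; first by apply: nearW.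
have hn := filter_forall (ae_filter_ringOfSetsType P) IH.
apply: filterS2 (cond_exp_average u hf) hn => w /= -> h; congr (_ - _).
by apply: eq_bigr => v _; exact: h.
Qed.

Lemma expectation_anova_sqr f u : lipschitz1 f ->
  ('E_P[fun w => (anova_comp X f u w ^+ 2)%R]
   = (inner P V (component P V f u) (component P V f u))%:E)%E.
Proof.
move=> hf; have hc := lipschitz1_component mV sqV hf u.
rewrite unlock /inner /Rintegral fineK; last first.
  apply: integrable_fin_num => //.
  exact: (integrable_lipschitz1M mV sqV hc hc).
apply: ae_eq_integral => //.
- by apply/measurable_EFinP/measurable_funX; exact: measurable_anova_rec.
- apply/measurable_EFinP/measurable_funM; exact: (measurable_lipschitz1V mV hc).
- apply: filterS (anova_rec_component #|u|.+1 u hf) => w h _.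
  by rewrite /anova_comp h expr2.
Qed.

End conditional_expectations.

(** * Mean dimension *)

Section mean_dimension_bound.
Context (disp : measure_display) (T : measurableType disp) (R : realType)
  (P : probability T R) (d : nat) (X : 'I_d -> {RV P >-> R}).
Local Notation V := (random_vector X).
Context
  (indV : forall A : 'I_d -> set R, (forall j, measurable (A j)) ->
    (P (V @^-1` rect A)
     = \prod_j P ((fun w => V w j ord0) @^-1` A j))%E)
  (sqV : forall j, P.-integrable setT (fun w => (V w j ord0 ^+ 2)%:E))
  (f : 'cV[R]_d -> R) (hf : lipschitz1 f).

Let mV : forall j, measurable_fun setT (fun w => V w j ord0) :=
  measurable_random_vector X.
Local Notation comp u := (component P V f u).

Lemma inner_full : inner P V f f =
  \sum_(u : {set 'I_d}) inner P V (comp u) (comp u).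
Proof.
have := inner_average_component mV indV sqV hf [set: 'I_d]%SET.
rewrite average_id; last by move=> x y; rewrite mixT.
by move=> ->; apply: eq_bigl => u; exact: finset.subsetT.
Qed.

(** The empty set is excluded from [anova_var]; its share of [inner P V f f] is what separates the
    second moment from the variance. *)
Lemma inner_component0 : inner P V (comp finset.set0) (comp finset.set0)
  = (\int[P]_w f (V w)) ^+ 2.
Proof.
have := inner_average_component mV indV sqV hf finset.set0.
rewrite (big_pred1 finset.set0) => [<-|u]; last by rewrite finset.subset0.
have E x : average P V finset.set0 f x = \int[P]_w f (V w).
  by apply: eq_Rintegral => w _; congr f; apply/colP => j; rewrite mixE inE.
rewrite /inner; under eq_Rintegral do rewrite !E.
by rewrite Rintegral_prob_cst expr2.
Qed.

Lemma anova_varE u : anova_var X f u =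
  if u == finset.set0 then 0 else inner P V (comp u) (comp u).
Proof.
by rewrite /anova_var; case: ifP => // _; rewrite expectation_anova_sqr.
Qed.

Lemma sum_anova_var :
  \sum_(u : {set 'I_d}) anova_var X f u
  = inner P V f f - (\int[P]_w f (V w)) ^+ 2.
Proof.
rewrite inner_full -inner_component0 (bigD1 finset.set0)//= anova_varE eqxx.
rewrite add0r [in RHS](bigD1 finset.set0)//= addrAC subrr add0r.
by apply: eq_bigr => u /negPf u0; rewrite anova_varE u0.
Qed.

(** Count [#|u|] as the number of [j] in [u] and exchange the sums. The sets avoiding [j] are the
    subsets of [~: [set j]], whose squared norms add up to that of the average for [~: [set j]];
    subtracting them leaves the sets that contain [j]. *)
Lemma sum_card_anova_var :
  \sum_(u : {set 'I_d}) #|u|%:R * anova_var X f u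
  = \sum_j (inner P V f f - inner P V (average P V (~: [set j])%SET f)
                                      (average P V (~: [set j])%SET f)).
Proof.
transitivity (\sum_(u : {set 'I_d}) \sum_(j | j \in u)
    inner P V (comp u) (comp u)).
  apply: eq_bigr => u _; rewrite anova_varE sumr_const mulr_natl.
  by case: eqP => // ->; rewrite cards0 !mulr0n.
rewrite (exchange_big_dep xpredT)//=; apply: eq_bigr => j _.
rewrite inner_average_component// inner_full.
rewrite [X in _ = X - _](bigID (fun u : {set 'I_d} => j \in u)) /=.
rewrite [X in _ + X - _](eq_bigl
  (fun u : {set 'I_d} => u \subset ~: [set j])%SET).
  by rewrite addrK.
by move=> u; rewrite -finset.disjoints_subset disjoint_sym disjoints1.
Qed.

Lemma mean_dimension_le (b : 'I_d -> R) :
  0 < inner P V f f - (\int[P]_w f (V w)) ^+ 2 ->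
  (forall j, exists h, [/\ lipschitz1 h, depends_on (~: [set j])%SET h
    & inner P V (fun x => f x - h x) (fun x => f x - h x) <= b j]) ->
  mean_dimension X f
  <= (\sum_j b j) / (inner P V f f - (\int[P]_w f (V w)) ^+ 2).
Proof.
move=> var0 hb; rewrite /mean_dimension sum_anova_var.
rewrite ler_pM2r ?invr_gt0// sum_card_anova_var; apply: ler_sum => j _.
have [h [hh jh hbj]] := hb j; apply: le_trans hbj.
exact: (inner_sub_average_le mV indV sqV hf hh jh).
Qed.

End mean_dimension_bound.

(** * The standard Gaussian measure *)

Section lebesgue_integrals.
Context {R : realType}.
Local Notation mu := (@lebesgue_measure R).
Local Notation phi := (@normal_pdf R 0 1).

(** The pushforward of Lebesgue measure under a translation gives intervals their length, which
    characterises Lebesgue measure. *)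
Lemma ge0_integral_addr (a : R) (h : R -> \bar R) :
  measurable_fun setT h -> (forall x, 0 <= h x)%E ->
  (\int[mu]_x h (x + a)%R = \int[mu]_x h x)%E.
Proof.
move=> mh h0.
have ma : measurable_fun setT ((fun x => x + a) : R -> measurableTypeR R).
  exact: measurable_funD.
transitivity
  (\int[pushforward mu ((fun x => x + a)%R : R -> measurableTypeR R)]_x h x)%E.
  by rewrite ge0_integral_pushforward.
apply: eq_measure_integral => A mA _.
apply/esym/lebesgue_measure_unique => //= _ [[b c]] _ <-.
rewrite /pushforward (_ : _ @^-1` _ = `]b - a, c - a]%classic); last first.
  by apply/seteqP; split => x /=; rewrite !in_itv /= lerBrDr ltrBlDr.
rewrite !lebesgue_measure_itv/= !lte_fin ltrD2r.
by case: ifP => // _; rewrite -!EFinB; congr EFin; ring.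
Qed.

(** The Radon-Nikodym derivative of the normal law and its density have the same integral over every
    measurable set, hence agree almost everywhere. *)
Lemma ge0_integral_normal_prob (h : R -> \bar R) :
  measurable_fun setT h -> (forall x, 0 <= h x)%E ->
  (\int[normal_prob 0 1]_x h x = \int[mu]_x (h x * (phi x)%:E))%E.
Proof.
move=> mh h0.
have dom : normal_prob 0 1 `<< mu by exact: normal_prob_dominates.
rewrite -(Radon_Nikodym_SigmaFinite.change_of_variables dom)//.
have iRN := Radon_Nikodym_SigmaFinite.f_integrable dom.
have mphi : measurable_fun setT (EFin \o phi).
  by apply/measurable_EFinP; exact: measurable_normal_pdf.
apply: ae_eq_integral => //.
- by apply: emeasurable_funM => //; exact: (measurable_int _ iRN).
- exact: emeasurable_funM.
apply: filterS (integral_ae_eq measurableT iRN mphi _) => [x /= hx _|E _ mE].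
  by rewrite hx.
by rewrite -(Radon_Nikodym_SigmaFinite.f_integral dom).
Qed.

Lemma normal_pdf01E x : phi x = normal_peak 1 * expR (- x ^+ 2 / 2).
Proof.
rewrite normal_pdfE ?oner_neq0// /normal_fun subr0.
by rewrite expr1n.
Qed.

Lemma normal_pdf01M x y :
  phi x * phi y = normal_peak 1 ^+ 2 * expR (- (x ^+ 2 + y ^+ 2) / 2).
Proof. by rewrite !normal_pdf01E mulrACA -expRD -expr2 -mulrDl opprD. Qed.

(** Kept as an iterated integral so that a shear is, for each fixed outer variable, a translation of
    the inner one. *)
Definition integral2 (h : R * R -> \bar R) : \bar R :=
  (\int[mu]_x \int[mu]_y h (x, y))%E.

Lemma integral2_shear_snd (t : R) (h : R * R -> \bar R) :
  measurable_fun setT h -> (forall p, 0 <= h p)%E ->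
  integral2 (fun p => h (p.1, p.2 + t * p.1)) = integral2 h.
Proof.
move=> mh h0; apply: eq_integral => x _ /=.
rewrite (ge0_integral_addr (t * x) (h := fun y => h (x, y)))//.
by apply: (measurableT_comp mh); exact: measurable_pair1.
Qed.

Lemma integral2_swap (h : R * R -> \bar R) :
  measurable_fun setT h -> (forall p, 0 <= h p)%E ->
  integral2 h = integral2 (fun p => h (p.2, p.1)).
Proof.
move=> mh h0; rewrite /integral2 /=.
exact: (fubini_tonelli (m1 := mu) (m2 := mu) h mh h0).
Qed.

(** The previous shear, with the roles of the variables exchanged by Tonelli. *)
Lemma integral2_shear_fst (t : R) (h : R * R -> \bar R) :
  measurable_fun setT h -> (forall p, 0 <= h p)%E ->
  integral2 (fun p => h (p.1 + t * p.2, p.2)) = integral2 h.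
Proof.
move=> mh h0.
have msw : measurable_fun setT (fun p : R * R => h (p.2, p.1)).
  apply: (measurableT_comp mh).
  by apply: measurable_fun_pair; [exact: measurable_snd|exact: measurable_fst].
rewrite integral2_swap//; last first.
  apply: (measurableT_comp mh).
  apply: measurable_fun_pair; last exact: measurable_snd.
  apply: measurable_funD; first exact: measurable_fst.
  by apply: measurable_funM; [exact: measurable_cst|exact: measurable_snd].
by rewrite (integral2_shear_snd t msw)// [RHS]integral2_swap.
Qed.
Definition rot2 (c s : R) (p : R * R) : R * R :=
  (c * p.1 + s * p.2, - s * p.1 + c * p.2).

Lemma measurable_lincomb2 (a b : R) :
  measurable_fun setT (fun p : R * R => a * p.1 + b * p.2).
Proof.
apply: measurable_funD; apply: measurable_funM;
  [exact: measurable_cst|exact: measurable_fst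
  |exact: measurable_cst|exact: measurable_snd].
Qed.

Lemma measurable_rot2 c s : measurable_fun setT (rot2 c s).
Proof. by apply: measurable_fun_pair; exact: measurable_lincomb2. Qed.

(* A rotation with [c != -1] is a product of three shears, with
   [t = tan (angle / 2) = s / (1 + c)]. *)
Lemma integral2_rot2 (c s : R) (h : R * R -> \bar R) :
  c ^+ 2 + s ^+ 2 = 1 -> 0 <= c ->
  measurable_fun setT h -> (forall p, 0 <= h p)%E ->
  integral2 (h \o rot2 c s) = integral2 h.
Proof.
move=> cs c0 mh h0; pose t := s / (1 + c).
have tc : t * (1 + c) = s by rewrite divfK// gt_eqF// ltr_pwDl.
(* Because [s ^+ 2 = (1 - c) * (1 + c)]. *)
have ts : t * s = 1 - c.
  have c1 : 1 + c != 0 by rewrite gt_eqF// ltr_pwDl.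
  by apply: (mulIf c1); rewrite mulrAC tc; lra.
pose h1 (p : R * R) := h (p.1 + t * p.2, p.2).
pose h2 (p : R * R) := h1 (p.1, p.2 + - s * p.1).
have m1 : measurable_fun setT h1.
  apply: (measurableT_comp mh).
  apply: measurable_fun_pair; last exact: measurable_snd.
  by have := measurable_lincomb2 1 t; under eq_fun do rewrite mul1r.
have m2 : measurable_fun setT h2.
  apply: (measurableT_comp m1).
  apply: measurable_fun_pair; first exact: measurable_fst.
  have := measurable_lincomb2 (- s) 1.
  by under eq_fun do rewrite mul1r addrC.
rewrite (_ : h \o rot2 c s = fun p => h2 (p.1 + t * p.2, p.2)).
  rewrite (integral2_shear_fst t m2) => [|p]; last exact: h0.
  rewrite (integral2_shear_snd (- s) m1) => [|p]; last exact: h0.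
  exact: integral2_shear_fst.
apply/funext => -[x y]; rewrite /h2 /h1 /rot2 /=; congr h.
have cE : c = 1 - t * s by rewrite ts; ring.
congr (_, _); first by rewrite -{1}tc cE; ring.
by rewrite cE; ring.
Qed.

Local Notation gauss := (@normal_prob R 0 1).

Lemma gauss2E (S : set (R * R)) : measurable S ->
  ((gauss \x gauss) S
   = integral2 (fun p => (\1_S p)%:E * (phi p.1 * phi p.2)%:E))%E.
Proof.
move=> mS; rewrite /product_measure1.
rewrite ge0_integral_normal_prob//; last exact: measurable_fun_xsection.
apply: eq_integral => x _; rewrite /= /normal_prob integral_mkcond.
have mphi : measurable_fun setT phi by exact: measurable_normal_pdf.
rewrite -ge0_integralZr//; last 3 first.
- apply: (measurable_restrictT _ _).1 => //; first exact: measurable_xsection.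
  exact/measurable_funTS/measurable_EFinP.
- by move=> y _; rewrite patchE; case: ifP; rewrite // lee_fin normal_pdf_ge0.
- by rewrite lee_fin normal_pdf_ge0.
apply: eq_integral => y _; rewrite patchE indicE mem_xsection.
by case: ifP => _; rewrite ?mul1e ?mul0e// -EFinM mulrC.
Qed.

Lemma normal_pdf_rot2 c s p : c ^+ 2 + s ^+ 2 = 1 ->
  phi (rot2 c s p).1 * phi (rot2 c s p).2 = phi p.1 * phi p.2.
Proof.
move=> cs; rewrite [LHS]normal_pdf01M [RHS]normal_pdf01M.
suff -> : (rot2 c s p).1 ^+ 2 + (rot2 c s p).2 ^+ 2 = p.1 ^+ 2 + p.2 ^+ 2 by [].
transitivity ((c ^+ 2 + s ^+ 2) * (p.1 ^+ 2 + p.2 ^+ 2)).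
  by rewrite /rot2 /=; ring.
by rewrite cs mul1r.
Qed.

(** The Lebesgue integral is invariant under the rotation, and the product density depends only on
    the squared radius. *)
Lemma gauss2_rot2 (c s : R) (S : set (R * R)) :
  c ^+ 2 + s ^+ 2 = 1 -> 0 <= c -> measurable S ->
  ((gauss \x gauss) (rot2 c s @^-1` S) = (gauss \x gauss) S)%E.
Proof.
move=> cs c0 mS; have mrS : measurable (rot2 c s @^-1` S).
  by rewrite -[X in measurable X]setTI; exact: measurable_rot2.
rewrite (gauss2E mrS) (gauss2E mS) -[RHS](integral2_rot2 cs c0).
- congr integral2; apply/funext => p; rewrite [in RHS]/comp.
  by rewrite normal_pdf_rot2.
- apply: emeasurable_funM; apply/measurable_EFinP.
    exact: measurable_indic.
  apply: measurable_funM; apply: measurableT_comp;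
    by [exact: measurable_normal_pdf|exact: measurable_fst
       |exact: measurable_snd].
- by move=> p; rewrite mule_ge0// lee_fin ?mulr_ge0// normal_pdf_ge0.
Qed.

Lemma gauss_oppr (A : set R) : measurable A -> gauss (-%R @^-1` A) = gauss A.
Proof.
move=> mA; rewrite /normal_prob.
transitivity
  (\int[mu]_(x in (-%R : R -> measurableTypeR R) @^-1` A) (phi (- x))%:E)%E.
  by apply: eq_integral => x _; rewrite !normal_pdf01E sqrrN.
have mphi : measurable_fun setT (EFin \o phi).
  by apply/measurable_EFinP; exact: measurable_normal_pdf.
transitivity
  (\int[pushforward mu (-%R : R -> measurableTypeR R)]_(x in A) (phi x)%:E)%E.
  rewrite ge0_integral_pushforward//; first exact: measurable_funTS.
  by move=> x _; rewrite lee_fin normal_pdf_ge0.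
by apply: eq_measure_integral => B mB _; exact: lebesgue_measureN.
Qed.
End lebesgue_integrals.

(** * Gaussian vectors *)

(** One product formula encodes independence together with the normal marginals, and it makes sense
    for any vector-valued map, such as the image of [V] under [Theta^T]. *)
Definition gaussian_vector (disp : measure_display) (T : measurableType disp)
    (R : realType) (P : probability T R) (n : nat) (V : T -> 'cV[R]_n) : Prop :=
  (forall j, measurable_fun setT (fun w => V w j ord0)) /\
  forall A : 'I_n -> set R, (forall j, measurable (A j)) ->
    (P (V @^-1` rect A) = \prod_j normal_prob 0 1 (A j))%E.

(** Left multiplication by a plane rotation, for any number of columns, so that the same operation
    acts on [Theta] and on the vector [V w]. *)
Definition rotm (R : realType) (d n : nat) (i k : 'I_d) (c s : R)
    (M : 'M[R]_(d, n)) : 'M[R]_(d, n) :=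
  \matrix_(a, b) (if a == i then c * M i b + s * M k b
                  else if a == k then - s * M i b + c * M k b else M a b).

Definition flipm (R : realType) (d n : nat) (i : 'I_d)
    (M : 'M[R]_(d, n)) : 'M[R]_(d, n) :=
  \matrix_(a, b) (if a == i then - M i b else M a b).

(** With [M := Theta], the choice [N := Theta] preserves orthonormality and the choice [N := V w]
    preserves the image vector. *)
Lemma rotm_mul (R : realType) (d m n : nat) (i k : 'I_d) (c s : R)
    (M : 'M[R]_(d, m)) (N : 'M[R]_(d, n)) :
  i != k -> c ^+ 2 + s ^+ 2 = 1 ->
  (rotm i k c s M)^T *m rotm i k c s N = M^T *m N.
Proof.
move=> ik cs; apply/matrixP => a b; rewrite !mxE.
have ki : (k == i) = false by rewrite eq_sym (negPf ik).
rewrite (bigD1 i)//= (bigD1 k) ?ki//= [RHS](bigD1 i)//=.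
rewrite [X in _ = _ + X](bigD1 k) ?ki//= !addrA; congr (_ + _).
  rewrite !mxE !eqxx ki.
  transitivity ((c ^+ 2 + s ^+ 2) * (M i a * N i b + M k a * N k b)).
    by ring.
  by rewrite cs mul1r.
by apply: eq_bigr => j /andP[/negPf ji /negPf jk]; rewrite !mxE ji jk.
Qed.

Lemma flipm_mul (R : realType) (d m n : nat) (i : 'I_d)
    (M : 'M[R]_(d, m)) (N : 'M[R]_(d, n)) :
  (flipm i M)^T *m flipm i N = M^T *m N.
Proof.
apply/matrixP => a b; rewrite !mxE; apply: eq_bigr => j _; rewrite !mxE.
by case: eqP => [->|//]; rewrite mulrNN.
Qed.

Section gaussian_vectors.
Context (disp : measure_display) (T : measurableType disp) (R : realType)
  (P : probability T R).
Local Notation gauss := (@normal_prob R 0 1).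

Lemma prod_gauss2 (n : nat) (i k : 'I_n) (A B : set R) : i != k ->
  (\prod_(j < n) gauss (if j == i then A else if j == k then B else setT)
   = gauss A * gauss B)%E.
Proof.
move=> ik; have ki : (k == i) = false by rewrite eq_sym (negPf ik).
rewrite (bigD1 i)//= eqxx (bigD1 k) ?ki//= eqxx big1 ?mule1// => j.
move=> /andP[/negPf -> /negPf ->].
exact: probability_setT.
Qed.

Lemma prod_gauss1 (n : nat) (i : 'I_n) (A : set R) :
  (\prod_(j < n) gauss (if j == i then A else setT) = gauss A)%E.
Proof.
rewrite (bigD1 i)//= eqxx big1 ?mule1// => j /negPf ->.
exact: probability_setT.
Qed.

Section coordinates.
Context (n : nat) (V : T -> 'cV[R]_n) (gV : gaussian_vector P V).

Lemma gaussian_coord j (A : set R) : measurable A ->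
  P ((fun w => V w j ord0) @^-1` A) = gauss A.
Proof.
move=> mA; rewrite -(prod_gauss1 j) -gV.2; last by move=> a; case: ifP.
congr (P _); apply/seteqP; split => w /=.
  by move=> Aw a; case: eqP => [->|].
by move=> /(_ j); rewrite eqxx.
Qed.

Lemma gaussian_indep (A : 'I_n -> set R) : (forall j, measurable (A j)) ->
  (P (V @^-1` rect A) = \prod_j P ((fun w => V w j ord0) @^-1` A j))%E.
Proof.
by move=> mA; rewrite gV.2//; apply: eq_bigr => j _; rewrite gaussian_coord.
Qed.

(** The joint law agrees with the product measure on rectangles, which determine it. *)
Lemma gaussian_pair (i k : 'I_n) (S : set (R * R)) : i != k -> measurable S ->
  P ((fun w => (V w i ord0, V w k ord0)) @^-1` S) = (gauss \x gauss)%E S.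
Proof.
move=> ik mS; have [mV _] := gV.
have mp : measurable_fun setT (fun w =>
    (V w i ord0 : measurableTypeR R, V w k ord0 : measurableTypeR R)).
  by apply: measurable_fun_pair; [exact: mV i|exact: mV k].
pose W : {mfun T >-> (measurableTypeR R * measurableTypeR R)%type} :=
  mfun_Sub (mem_set mp).
symmetry; apply: (product_measure_unique (m1 := gauss) (m2 := gauss)
  (m' := distribution P W)) => // A B mA mB.
rewrite -(prod_gauss2 A B ik) -gV.2; last first.
  by move=> j; case: ifP => // _; case: ifP.
congr (P _); apply/seteqP; split => w /=.
  by move=> [Aw Bw] j; case: eqP => [->|_]//; case: eqP => [->|].
move=> h; split; first by have := h i; rewrite eqxx.
by have := h k; rewrite eqxx eq_sym (negPf ik).
Qed.

(* By [law_mix], the coordinates [i] and [k] may be taken from an independent copy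
   of [V], where the event becomes a product. *)
Lemma gaussian_pair_indep (i k : 'I_n) (A : 'I_n -> set R) (S : set (R * R)) :
  i != k -> (forall j, measurable (A j)) -> measurable S ->
  let E := [set w | forall j, j != i -> j != k -> A j (V w j ord0)] in
  (P (E `&` (fun w => (V w i ord0, V w k ord0)) @^-1` S)
   = P E * (gauss \x gauss) S)%E.
Proof.
move=> ik mA mS E; have [mV _] := gV; rewrite -(gaussian_pair ik mS).
pose u := (~: [set i; k])%SET.
have inu j : (j \in u) = (j != i) && (j != k) by rewrite !inE negb_or.
pose B : set 'cV[R]_n := [set x | (forall j, j != i -> j != k -> A j (x j ord0))
  /\ S (x i ord0, x k ord0)].
pose A' j := if j \in u then A j else setT.
have mA' j : measurable (A' j) by rewrite /A'; case: ifP.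
have EA' : E = V @^-1` rect A'.
  apply/seteqP; split => w /= h j.
    by rewrite /A' inu; case: ifP => // /andP[]; exact: h.
  by move=> ji jk; have := h j; rewrite /A' inu ji jk.
have mE : measurable E by rewrite EA'; exact: measurable_preimage_rect.
have mpair : measurable ((fun w => (V w i ord0, V w k ord0)) @^-1` S).
  rewrite -[X in measurable X]setTI.
  by have := measurable_fun_pair (mV i) (mV k); apply.
have mB : measurable (B : set (vecType R n)).
  have mc j : measurable_fun [set: vecType R n] (fun x : 'cV[R]_n => x j ord0).
    by apply: measurable_coord; rewrite inE.
  rewrite (_ : B = rect A'
      `&` (fun x : 'cV[R]_n => (x i ord0, x k ord0)) @^-1` S).
    apply: measurableI.
      exact: (@measurable_preimage_rect R n _ (vecType R n) id).
    rewrite -[X in measurable X]setTI.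
    by have := measurable_fun_pair (mc i) (mc k); apply.
  apply/seteqP; split => x [h hS]; split => // j.
    by rewrite /A' inu; case: ifP => // /andP[]; exact: h.
  by move=> ji jk; have := h j; rewrite /A' inu ji jk.
have := law_mix mV gaussian_indep u (phi := EFin \o \1_B) _.
rewrite /=.
have -> : (\int[P]_w (\1_B (V w))%:E
    = P (E `&` (fun w => (V w i ord0, V w k ord0)) @^-1` S))%E.
  rewrite -[X in _ = _ X]setIT -integral_indic//; exact: measurableI.
have -> : (\int[P \x P]_p (\1_B (mix u (V p.1) (V p.2)))%:E
    = (P \x P) (E `*` (fun w => (V w i ord0, V w k ord0)) @^-1` S))%E.
  rewrite -[X in _ = _ X]setIT -integral_indic//; last exact: measurableX.
  apply: eq_integral => p _; rewrite !indicE; congr (_%:R%:E).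
  apply: congr1; apply/idP/idP; rewrite !inE /B /= !mixE !inu !eqxx /= andbF.
    move=> [h hS]; split => // j ji jk.
    by have := h j ji jk; rewrite mixE inu ji jk.
  by move=> [h hS]; split => // j ji jk; rewrite mixE inu ji jk; exact: h.
rewrite product_measure1E// => <- //.
by apply/measurable_EFinP; exact: measurable_indic.
Qed.

End coordinates.

(** Only the pair of coordinates [i], [k] is affected, and it is independent of the others and has a
    rotation-invariant law. *)
Lemma gaussian_rotm (n : nat) (V : T -> 'cV[R]_n) (i k : 'I_n) (c s : R) :
  i != k -> c ^+ 2 + s ^+ 2 = 1 -> 0 <= c ->
  gaussian_vector P V -> gaussian_vector P (fun w => rotm i k c s (V w)).
Proof.
move=> ik cs c0 gV; have [mV _] := gV.
have mlin (a b : R) j l : measurable_fun setT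
    (fun w => a * V w j ord0 + b * V w l ord0).
  by apply: measurable_funD; apply: measurable_funM => //;
    exact: measurable_cst.
split=> [j|A mA].
  under eq_fun do rewrite mxE.
  by case: (j == i); [|case: (j == k)]; [exact: mlin|exact: mlin|exact: mV].
rewrite -gV.2//.
pose E := [set w | forall j, j != i -> j != k -> A j (V w j ord0)].
pose S := A i `*` A k.
have mS : measurable S by exact: measurableX.
have mrS : measurable (rot2 c s @^-1` S).
  by rewrite -[X in measurable X]setTI; exact: measurable_rot2.
rewrite (_ : _ @^-1` _ =
    E `&` (fun w => (V w i ord0, V w k ord0)) @^-1` (rot2 c s @^-1` S)).
  rewrite (gaussian_pair_indep gV ik mA mrS) gauss2_rot2//.
  rewrite -(gaussian_pair_indep gV ik mA mS); congr (P _).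
  apply/seteqP; split => [w [h [hi hk]] j|w h].
    by have [->//|ji] := eqVneq j i; have [->//|jk] := eqVneq j k; exact: h.
  by split => [j _ _|]; [exact: h|split; exact: h].
have ki : (k == i) = false by rewrite eq_sym (negPf ik).
apply/seteqP; split => [w h|w [h [/= hi hk]] j].
  split=> [j /negPf ji /negPf jk|]; first by have := h j; rewrite /= mxE ji jk.
  split; first by have := h i; rewrite /= mxE eqxx.
  by have := h k; rewrite /= mxE ki eqxx.
rewrite /= mxE; case: ifPn => [/eqP ->//|ji]; case: ifPn => [/eqP ->//|jk].
exact: h.
Qed.

Lemma gaussian_flipm (n : nat) (V : T -> 'cV[R]_n) (i : 'I_n) :
  gaussian_vector P V -> gaussian_vector P (fun w => flipm i (V w)).
Proof.
move=> [mV gV]; split=> [j|A mA].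
  under eq_fun do rewrite mxE.
  by case: (j == i); [exact: (measurable_funN (mV i))|exact: mV].
pose A' j := if j == i then -%R @^-1` A j else A j.
have mA' j : measurable (A' j).
  rewrite /A'; case: ifP => // _; rewrite -[X in measurable X]setTI.
  exact: oppr_measurable.
transitivity (P (V @^-1` rect A')).
  congr (P _); apply/seteqP; split => w /= h j; have := h j;
    by rewrite /A' mxE; case: eqP => [->|].
rewrite gV//; apply: eq_bigr => j _; rewrite /A'; case: ifP => // _.
exact: gauss_oppr.
Qed.

End gaussian_vectors.

(** * Second moment of the standard normal distribution *)

Section normal_second_moment.
Context {R : realType}.
Local Notation mu := (@lebesgue_measure R).

Lemma normal_peakM (s : R) : 0 < s -> s * normal_peak s = normal_peak 1.
Proof.
move=> s0; rewrite /normal_peak expr1n mul1r -mulrnAr sqrtrM ?sqr_ge0//.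
by rewrite sqrtr_sqr gtr0_norm// invfM mulrA divff ?gt_eqF// mul1r.
Qed.

(* [exp (delta x^2 / 2) >= 1 + delta x^2 / 2] times the standard density, with
   [delta = 1 - 1 / s^2], compares it to the density of standard deviation [s]. *)
Lemma sqr_normal_pdf_le (s x : R) : 1 < s ->
  x ^+ 2 * normal_pdf 0 1 x + 2 * s ^+ 2 / (s ^+ 2 - 1) * normal_pdf 0 1 x
  <= 2 * s ^+ 2 / (s ^+ 2 - 1) * s * normal_pdf 0 s x.
Proof.
move=> s1; have s0 : 0 < s by exact: lt_trans s1.
have d0 : 0 < s ^+ 2 - 1 by rewrite subr_gt0 expr_gt1// ltW.
rewrite normal_pdf01E normal_pdfE ?gt_eqF// /normal_fun subr0.
rewrite -(normal_peakM s0).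
have K0 : 0 <= s * normal_peak s by rewrite mulr_ge0 ?normal_peak_ge0// ltW.
(* Here [D = 2 / delta]; multiplying the exponential inequality by [D] isolates [x ^+ 2]. *)
set D := 2 * s ^+ 2 / (s ^+ 2 - 1).
have D0 : 0 < D by rewrite divr_gt0// mulr_gt0// exprn_gt0.
have -> : - x ^+ 2 / (s ^+ 2 *+ 2) = - x ^+ 2 / 2 + x ^+ 2 / D.
  rewrite /D -mulr_natr; field.
  by rewrite !gt_eqF// exprn_gt0.
rewrite expRD; set e := expR (- x ^+ 2 / 2).
have e0 : 0 <= s * normal_peak s * e by rewrite mulr_ge0// expR_ge0.
have := expR_ge1Dx (x ^+ 2 / D); set E := expR (x ^+ 2 / D).
rewrite -(ler_pM2l D0) mulrDr mulr1 mulrCA divff ?gt_eqF// mulr1 => hE.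
have := ler_wpM2l e0 hE; set K := normal_peak s.
rewrite (_ : _ * (D + x ^+ 2)
  = x ^+ 2 * (s * K * e) + D * (s * K * e)); last by ring.
by rewrite (_ : _ * (D * E) = D * s * (K * (e * E))); last by ring.
Qed.

(** Integrating [sqr_normal_pdf_le] gives [E + D <= D * s], that is [E <= 2 * s ^+ 2 / (s + 1)] for
    every [s > 1], and this bound tends to 1 as [s] decreases to 1. No integration by parts is
    involved. *)
Lemma normal_second_moment_le1 :
  (\int[normal_prob 0 1]_x (x ^+ 2)%:E <= (1 : R)%:E)%E.
Proof.
rewrite ge0_integral_normal_prob//; last first.
- by move=> x; rewrite lee_fin sqr_ge0.
- by apply/measurable_EFinP; exact: exprn_measurable.
under eq_integral do rewrite -EFinM.
set E := (\int[_]_x _)%E.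
have mphi s : measurable_fun setT (@normal_pdf R 0 s).
  exact: measurable_normal_pdf.
have m2 : measurable_fun setT (fun x : R => x ^+ 2 * normal_pdf 0 1 x).
  by apply: measurable_funM => //; exact: exprn_measurable.
have mD c s : measurable_fun setT (fun x : R => c * @normal_pdf R 0 s x).
  by apply: measurable_funM; [exact: measurable_cst|exact: mphi].
apply/lee_addgt0Pr => e e0; rewrite -EFinD.
pose s := 1 + e / 2; have s1 : 1 < s by rewrite ltrDl divr_gt0.
have s0 : 0 < s by exact: lt_trans s1.
have d0 : 0 < s ^+ 2 - 1 by rewrite subr_gt0 expr_gt1// ltW.
set D := 2 * s ^+ 2 / (s ^+ 2 - 1).
have D0 : 0 <= D by rewrite divr_ge0 ?mulr_ge0 ?sqr_ge0// ltW.
have : (E + D%:E <= (D * s)%:E)%E.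
  have -> : D%:E = (\int[mu]_x (D * normal_pdf 0 1 x)%:E)%E.
    under eq_integral do rewrite EFinM.
    rewrite ge0_integralZl//.
    - by rewrite integral_normal_pdf mule1.
    - by apply/measurable_EFinP; exact: mphi.
    - by move=> x _; rewrite lee_fin normal_pdf_ge0.
  have -> : (D * s)%:E = (\int[mu]_x (D * s * normal_pdf 0 s x)%:E)%E.
    under eq_integral do rewrite EFinM.
    rewrite ge0_integralZl//.
    - by rewrite integral_normal_pdf mule1.
    - by apply/measurable_EFinP; exact: mphi.
    - by move=> x _; rewrite lee_fin normal_pdf_ge0.
    - by rewrite lee_fin mulr_ge0// ltW.
  rewrite -ge0_integralD//; last 4 first.
  - by move=> x _; rewrite lee_fin mulr_ge0 ?sqr_ge0 ?normal_pdf_ge0.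
  - by apply/measurable_EFinP; exact: m2.
  - by move=> x _; rewrite lee_fin mulr_ge0 ?normal_pdf_ge0.
  - by apply/measurable_EFinP; exact: mD.
  apply: ge0_le_integral => //.
  - move=> x _; rewrite -EFinD lee_fin addr_ge0// mulr_ge0 ?sqr_ge0//;
      exact: normal_pdf_ge0.
  - by apply: emeasurable_funD; apply/measurable_EFinP; [exact: m2|exact: mD].
  - by apply/measurable_EFinP; exact: mD.
  - by move=> x _; rewrite -EFinD lee_fin; exact: sqr_normal_pdf_le.
rewrite -leeBrDr// => /le_trans; apply; rewrite -EFinB lee_fin.
have n1 : s + 1 != 0 by rewrite gt_eqF// addr_gt0.
have n2 : s ^+ 2 - 1 != 0 by rewrite gt_eqF.
(* As [(2 * s + 1) / (s + 1) < 2], the excess over 1 is at most [2 * (s - 1) = e], which explains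
   the choice of [s]. *)
have -> : D * s - D = 1 + (2 * s + 1) * (s - 1) / (s + 1).
  by rewrite /D; field; rewrite n1 n2.
rewrite lerD2l ler_pdivrMr; last by rewrite addr_gt0.
by rewrite /s; have := mulr_gt0 e0 e0; nra.
Qed.

End normal_second_moment.

(** * Image of a Gaussian vector under an orthonormal matrix *)

Section orthonormal_image.
Context (disp : measure_display) (T : measurableType disp) (R : realType)
  (P : probability T R) (d r : nat).
Implicit Types (Theta : 'M[R]_(d, r)) (V : T -> 'cV[R]_d).

(** Quantified over all [V], so that a rotation of [Theta] can be absorbed by rotating [V]. *)
Let maps_gaussian Theta := forall V, gaussian_vector P V ->
  gaussian_vector P (fun w => Theta^T *m V w).

Lemma maps_gaussian_pid : (r <= d)%N ->
  maps_gaussian (\matrix_(a, j) (a == j :> nat)%:R).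
Proof.
move=> rd V [mV gV].
pose w := widen_ord rd.
have E x j : ((\matrix_(a < d, j < r) (a == j :> nat)%:R)^T *m V x) j ord0
    = V x (w j) ord0.
  rewrite !mxE (bigD1 (w j))//= !mxE eqxx mul1r big1 ?addr0// => a aj.
  by rewrite !mxE (_ : (a == j :> nat) = false) ?mul0r//; apply/negbTE.
split=> [j|A mA]; first by under eq_fun do rewrite E; exact: mV.
(* The constraints are padded with the whole line from index [r] on; indexing by [nat] allows the
   product to be widened from [r] to [d] factors. *)
pose B n : set R := if insub n is Some j then A (j : 'I_r) else setT.
have Bj (j : 'I_r) : B j = A j by rewrite /B valK.
have mB n : measurable (B n) by rewrite /B; case: insub.
transitivity (P (V @^-1` rect (fun a : 'I_d => B a))).
  congr (P _); apply/seteqP; split => x /= h j.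
    rewrite /B; case: insubP => [i _ ij|//].
    by rewrite (_ : j = w i); [rewrite -E; exact: h|apply/val_inj].
  by rewrite E -Bj; exact: h (w j).
rewrite gV//.
rewrite [RHS](eq_bigr (fun j : 'I_r => normal_prob 0 1 (B j))); last first.
  by move=> j _; rewrite Bj.
rewrite [RHS](big_ord_widen d (fun n => normal_prob 0 1 (B n)) rd).
rewrite [RHS]big_mkcond/=; apply: eq_bigr => a _; case: ifPn => // ar.
by rewrite /B insubN//; exact: probability_setT.
Qed.

Lemma maps_gaussian_rotm Theta i k c s : i != k -> c ^+ 2 + s ^+ 2 = 1 ->
  0 <= c -> maps_gaussian (rotm i k c s Theta) -> maps_gaussian Theta.
Proof.
move=> ik cs c0 h V gV; have := h _ (gaussian_rotm ik cs c0 gV).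
by under eq_fun do rewrite rotm_mul//.
Qed.

Lemma maps_gaussian_flipm Theta i :
  maps_gaussian (flipm i Theta) -> maps_gaussian Theta.
Proof.
move=> h V gV; have := h _ (gaussian_flipm i gV).
by under eq_fun do rewrite flipm_mul.
Qed.

(** [std_cols] and [std_below] are the invariants of the reduction: the finished columns, and the
    entries of column [k] below the diagonal that are already eliminated. *)
Let std_cols (k : nat) Theta := forall (a : 'I_d) (j : 'I_r), (j < k)%N ->
  Theta a j = (a == j :> nat)%:R.

Let std_below (k m : nat) Theta := forall (a : 'I_d) (j : 'I_r), j = k :> nat ->
  (k < a < m)%N -> Theta a j = 0.

(** For [y != 0] the pair [c], [s] is the normalised pair [x], [y], with both signs reversed when
    [x < 0] so that [0 <= c], the range covered by [gauss2_rot2]. *)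
Lemma exists_rotation (x y : R) : exists c s : R,
  [/\ c ^+ 2 + s ^+ 2 = 1, 0 <= c & - s * x + c * y = 0].
Proof.
have [->|y0] := eqVneq y 0.
  by exists 1, 0; rewrite expr1n expr0n addr0 oppr0 mul0r mulr0 addr0; split.
pose n := Num.sqrt (x ^+ 2 + y ^+ 2).
have n2 : n ^+ 2 = x ^+ 2 + y ^+ 2 by rewrite sqr_sqrtr// addr_ge0 ?sqr_ge0.
have n0 : 0 < n by rewrite sqrtr_gt0 ltr_wpDl ?sqr_ge0// exprn_even_gt0.
have nN : n != 0 by rewrite gt_eqF.
have [x0|x0] := leP 0 x.
  exists (x / n), (y / n); split; [|by rewrite divr_ge0// ltW|by field].
  by rewrite !expr_div_n -mulrDl -n2 divff// expf_neq0.
exists (- x / n), (- y / n).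
split; [|by rewrite divr_ge0 ?oppr_ge0// ltW|by field].
by rewrite !expr_div_n !sqrrN -mulrDl -n2 divff// expf_neq0.
Qed.

(* Givens rotations bring [Theta] to its first [r] unit vectors column by column;
   applying the same rotation to [V] does not change [Theta^T *m V]. *)
Lemma orthonormal_gaussian Theta V : (r <= d)%N -> Theta^T *m Theta = 1%:M ->
  gaussian_vector P V -> gaussian_vector P (fun w => Theta^T *m V w).
Proof.
move=> rd TT; move: V; rewrite -/(maps_gaussian Theta).
(* [n] bounds the number of columns left; [m'] in [inner_] bounds the number of rows left in the
   current column. *)
have main n k M : (r - k <= n)%N -> (k <= r)%N -> M^T *m M = 1%:M ->
    std_cols k M -> maps_gaussian M.
  elim: n k M => [|n IH] k M rkn kr MM sM.
    have -> : M = \matrix_(a, j) (a == j :> nat)%:R.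
      apply/matrixP => a j; rewrite mxE sM// (leq_trans (ltn_ord j))//.
      by rewrite -subn_eq0 -leqn0.
    exact: maps_gaussian_pid.
  have [rk|kr'] := leqP r k.
    by apply: (IH k) => //; rewrite (leq_trans _ (leq0n n))// leqn0 subn_eq0.
  pose kr_ : 'I_r := Ordinal kr'; pose kd : 'I_d := Ordinal (leq_trans kr' rd).
  have rkn' : (r - k.+1 <= n)%N by rewrite subnS; case: (r - k)%N rkn.
  have inner_ m m' N : (d - m <= m')%N -> (k < m)%N -> N^T *m N = 1%:M ->
      std_cols k N -> std_below k m N -> maps_gaussian N.
    elim: m' m N => [|m' IHm] m N dm km NN sN bN.
      have dm' : (d <= m)%N by rewrite -subn_eq0 -leqn0.
      (* Below the diagonal [std_below] applies; above it, orthogonality to the earlier columns,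
         which are unit vectors, forces zeros. *)
      have N0 (a : 'I_d) : a != kd -> N a kr_ = 0.
        move=> akd; have [ka|ak] := ltnP k a.
          by apply: bN => //; rewrite ka (leq_trans (ltn_ord a)).
        have ak' : (a < k)%N by rewrite ltn_neqAle ak andbT.
        pose ar : 'I_r := Ordinal (ltn_trans ak' kr').
        have := congr1 (fun A : 'M[R]_(r, r) => A ar kr_) NN; rewrite !mxE.
        rewrite (bigD1 a)//= !mxE sN//= eqxx mul1r big1 ?addr0.
          by move=> ->; rewrite -val_eqE /= ltn_eqF.
        move=> b ba; rewrite mxE sN//= (_ : (b == a :> nat) = false) ?mul0r//.
        exact/negbTE.
      have : N kd kr_ ^+ 2 = 1.
        have := congr1 (fun A : 'M[R]_(r, r) => A kr_ kr_) NN.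
        rewrite !mxE eqxx.
        rewrite (bigD1 kd)//= !mxE big1 ?addr0 ?expr2// => b bk.
        by rewrite N0// mulr0.
      (* The column has norm 1, so its diagonal entry is 1 or -1; a sign flip settles the second
         case. *)
      move=> /eqP; rewrite sqrf_eq1 => /orP[] /eqP N1.
        apply: (IH k.+1) => // a j.
        rewrite ltnS leq_eqVlt => /orP[/eqP jk|]; last exact: sN.
        have -> : j = kr_ by apply/val_inj.
        have [->|akd] := eqVneq a kd; first by rewrite N1 eqxx.
        by rewrite N0// (_ : (a == k :> nat) = false)//; apply/negbTE.
      apply: (@maps_gaussian_flipm _ kd); apply: (IH k.+1) => //.
        by rewrite flipm_mul.
      move=> a j; rewrite ltnS leq_eqVlt mxE => /orP[/eqP jk|jk].
        have -> : j = kr_ by apply/val_inj.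
        have [->|akd] := eqVneq a kd; first by rewrite N1 opprK eqxx.
        by rewrite N0// (_ : (a == k :> nat) = false)//; apply/negbTE.
      case: eqP => [->|_]; last exact: sN.
      by rewrite sN//= gtn_eqF// oppr0.
    have [dm'|md] := leqP d m.
      apply: (IHm m) => //.
      by rewrite (leq_trans _ (leq0n m'))// leqn0 subn_eq0.
    pose md_ : 'I_d := Ordinal md.
    have [c [s [cs c0 cs0]]] := exists_rotation (N kd kr_) (N md_ kr_).
    have kmd : kd != md_ by rewrite -val_eqE /= ltn_eqF.
    apply: (maps_gaussian_rotm kmd cs c0); apply: (IHm m.+1).
    - by rewrite subnS; case: (d - m)%N dm.
    - exact: ltnW.
    - by rewrite rotm_mul.
    - move=> a j jk.
      (* Rows [k] and [m] vanish in the finished columns, so the rotation leaves these columns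
         unchanged. *)
      rewrite mxE !sN//= (gtn_eqF jk) (gtn_eqF (ltn_trans jk km)).
      rewrite !mulr0 addr0; case: eqP => [->|_] /=; first by rewrite gtn_eqF.
      by case: eqP => [->|_] //=; rewrite gtn_eqF// (ltn_trans jk).
    - move=> a j jk /andP[ka am]; have -> : j = kr_ by apply/val_inj.
      rewrite mxE (_ : (a == kd) = false); last by rewrite -val_eqE /= gtn_eqF.
      case: eqP => [//|/eqP amd]; apply: bN => //; rewrite ka /=.
      by rewrite ltn_neqAle -ltnS am andbT.
  apply: (inner_ k.+1 (d - k.+1)%N) => // a j _ /andP[ka].
  by rewrite ltnS leqNgt ka.
by apply: (main r 0%N) => //; rewrite subn0.
Qed.

End orthonormal_image.

Lemma gaussian_random_vector (disp : measure_display) (T : measurableType disp)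
    (R : realType) (P : probability T R) (d : nat) (X : 'I_d -> {RV P >-> R}) :
  standard_gaussian X -> gaussian_vector P (random_vector X).
Proof.
move=> [indX gX]; split; first exact: measurable_random_vector.
move=> A mA.
transitivity (P (\bigcap_(j in [set` [set: 'I_d]%SET]) (X j @^-1` A j))).
  congr (P _); apply/seteqP; split => w /= h j; have := h j; rewrite mxE //.
  by apply; rewrite /= inE.
rewrite (indX _ A)// big_mkcond; apply: eq_bigr => j _; rewrite inE.
exact: gX.
Qed.

(** * Second moments of Gaussian vectors *)

Section gaussian_moments.
Context (disp : measure_display) (T : measurableType disp) (R : realType)
  (P : probability T R) (n : nat) (V : T -> 'cV[R]_n)
  (gV : gaussian_vector P V).

Lemma gaussian_second_moment_le1 j :
  (\int[P]_w (V w j ord0 ^+ 2)%:E <= (1 : R)%:E)%E.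
Proof.
have mV := gV.1 j : @measurable_fun _ _ T (measurableTypeR R) setT _.
pose W : {mfun T >-> measurableTypeR R} :=
  mfun_Sub (mem_set mV : _ \in @mfun _ _ T (measurableTypeR R)).
apply: le_trans (@normal_second_moment_le1 R).
have m2 : measurable_fun [set: measurableTypeR R] (fun x : R => (x ^+ 2)%:E).
  by apply/measurable_EFinP; exact: exprn_measurable.
have h0 (x : R) : (0 <= (x ^+ 2)%:E)%E by rewrite lee_fin sqr_ge0.
rewrite -(ge0_integral_distribution W m2 h0) le_eqVlt.
apply/orP; left; apply/eqP.
apply: eq_measure_integral => A mA _.
exact: (gaussian_coord gV j mA).
Qed.

Lemma gaussian_sqr_integrable j :
  P.-integrable setT (fun w => (V w j ord0 ^+ 2)%:E).
Proof.
have mV := gV.1 j; apply/integrableP; split.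
  by apply/measurable_EFinP; exact: measurable_funX.
under eq_integral do rewrite gee0_abs ?lee_fin ?sqr_ge0//.
exact: le_lt_trans (gaussian_second_moment_le1 j) (ltry _).
Qed.

End gaussian_moments.

(** * Lipschitz functions for the Euclidean norm *)

Section lipschitz_euclid_theory.
Context (R : realType).

Lemma sum_sqr_le_sqr_sum (I : Type) (s : seq I) (F : I -> R) :
  (forall i, 0 <= F i) -> \sum_(i <- s) F i ^+ 2 <= (\sum_(i <- s) F i) ^+ 2.
Proof.
move=> F0; elim: s => [|i s IH]; first by rewrite !big_nil expr0n.
rewrite !big_cons sqrrD -addrA lerD2l (le_trans IH)// lerDr mulrn_wge0//.
by rewrite mulr_ge0// sumr_ge0.
Qed.

Lemma euclid_norm_le_dist1 (n : nat) (x y : 'cV[R]_n) :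
  euclid_norm (x - y) <= dist1 x y.
Proof.
rewrite -(ler_sqr _ (dist1_ge0 x y)) ?nnegrE ?sqrtr_ge0//.
rewrite sqr_sqrtr; last by apply: sumr_ge0 => i _; exact: sqr_ge0.
apply: le_trans (sum_sqr_le_sqr_sum _ _) => //.
by apply: ler_sum => i _; rewrite !mxE real_normK ?num_real.
Qed.

Lemma lipschitz_euclid_lipschitz1 (n : nat) (C : R) (g : 'cV[R]_n -> R) :
  lipschitz_euclid C g -> lipschitz1 g.
Proof.
move=> hg; exists `|C| => // x y; apply: le_trans (hg x y) _.
apply: le_trans (ler_wpM2r _ (ler_norm C)) _; first exact: sqrtr_ge0.
by rewrite ler_wpM2l// euclid_norm_le_dist1.
Qed.

Lemma lipschitz1_mulmx (m n : nat) (A : 'M[R]_(m, n)) (g : 'cV[R]_m -> R) :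
  lipschitz1 g -> lipschitz1 (fun x => g (A *m x)).
Proof.
move=> [K K0 hK]; exists (K * \sum_i \sum_j `|A i j|).
  by rewrite mulr_ge0// sumr_ge0// => i _; exact: sumr_ge0.
move=> x y; apply: le_trans (hK _ _) _; rewrite -mulrA ler_wpM2l//.
rewrite mulr_suml; apply: ler_sum => i _; rewrite mulr_suml.
rewrite !mxE -sumrB; apply: le_trans (ler_norm_sum _ _ _) _.
apply: ler_sum => j _; rewrite -mulrBr normrM ler_wpM2l//.
by rewrite /dist1 (bigD1 j)//= lerDl sumr_ge0.
Qed.

(* [x] and [mix (~: [set j]) x 0] differ only in coordinate [j]. *)
Lemma lipschitz_euclid_coord (d r : nat) (C : R) (g : 'cV[R]_r -> R)
    (Theta : 'M[R]_(d, r)) (j : 'I_d) (x : 'cV[R]_d) : lipschitz_euclid C g ->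
  (g (Theta^T *m x) - g (Theta^T *m mix (~: [set j])%SET x 0)) ^+ 2
  <= C ^+ 2 * (\sum_i Theta j i ^+ 2) * x j ord0 ^+ 2.
Proof.
move=> hg; have := hg (Theta^T *m x) (Theta^T *m mix (~: [set j])%SET x 0).
set D := _ - g _ => hD.
have : D ^+ 2 <= (C * euclid_norm
    (Theta^T *m x - Theta^T *m mix (~: [set j])%SET x 0)) ^+ 2.
  by rewrite -(real_normK (num_real D)) ler_sqr// nnegrE (le_trans _ hD).
move=> /le_trans; apply; rewrite exprMn sqr_sqrtr; last first.
  by apply: sumr_ge0 => i _; exact: sqr_ge0.
rewrite -mulmxBr -mulrA ler_wpM2l ?sqr_ge0// mulr_suml le_eqVlt.
apply/orP; left; apply/eqP/eq_bigr => i _; rewrite !mxE (bigD1 j)//=.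
rewrite !mxE !inE eqxx /= subr0.
rewrite big1 ?addr0 ?exprMn// => k kj.
by rewrite !mxE !inE kj (ord1 ord0) subrr mulr0.
Qed.

(** After exchanging the sums this is the trace of [Theta^T *m Theta]; it is the source of the
    factor [r] in the bound. *)
Lemma sum_sqr_orthonormal (d r : nat) (Theta : 'M[R]_(d, r)) :
  Theta^T *m Theta = 1%:M -> \sum_j \sum_i Theta j i ^+ 2 = r%:R.
Proof.
move=> TT; rewrite exchange_big /= -[r in RHS]card_ord -sumr_const.
apply: eq_bigr => i _; have := congr1 (fun A : 'M[R]_(r, r) => A i i) TT.
rewrite !mxE eqxx mulr1n => <-; apply: eq_bigr => j _.
by rewrite mxE expr2.
Qed.

End lipschitz_euclid_theory.

(** The law of a Gaussian vector is determined by its dimension, so the variance can be read off any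
    one of them. Applied in dimension [r] to the image under [Theta^T], it yields a value fixed
    before [d] and [Theta]. *)
Lemma gaussian_variance_unique (R : realType) (n : nat) (g : 'cV[R]_n -> R) :
  lipschitz1 g ->
  exists s : R, forall (disp : measure_display) (T : measurableType disp)
    (P : probability T R) (V : T -> 'cV[R]_n),
    gaussian_vector P V -> ('V_P[g \o V] = s%:E)%E.
Proof.
move=> hg.
have mg : measurable_fun [set: vecType R n] g.
  by apply: measurable_lipschitz1 => // x y; rewrite mixT.
have [[d1 [T1 [P1 [V1 gV1]]]]|none] := pselect (exists (disp : measure_display)
    (T : measurableType disp) (P : probability T R) (V : T -> 'cV[R]_n),
    gaussian_vector P V); last first.
  (* If there is no Gaussian vector at all, the claim is vacuous and 0 is an arbitrary value. *)
  by exists 0 => disp T P V gV; exfalso; apply: none; exists disp, T, P, V.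
exists (inner P1 V1 g g - (\int[P1]_w g (V1 w)) ^+ 2) => d2 T2 P2 V2 gV2.
rewrite (variance_lipschitz1 gV2.1 (gaussian_sqr_integrable gV2) hg).
have law (phi : vecType R n -> \bar R) : measurable_fun setT phi ->
    (\int[P2]_w phi (V2 w) = \int[P1]_w phi (V1 w))%E.
  apply: eq_law_integral; [exact: gV2.1|exact: gV1.1|].
  by move=> A mA; rewrite gV1.2// gV2.2.
congr (_ - _ ^+ 2)%:E; congr fine.
- apply: (law (fun x => (g x * g x)%:E)); apply/measurable_EFinP.
  exact: measurable_funM.
- by apply: (law (fun x => (g x)%:E)); apply/measurable_EFinP.
Qed.

Theorem corollary3p2 (R : realType) (r : nat) (g : 'cV[R]_r -> R) (C : R)
    (hr : (1 <= r)%N) (hg : lipschitz_euclid C g) :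
  exists sigma2 : R,
    forall (d : nat) (Theta : 'M[R]_(d, r))
      (disp : measure_display) (T : measurableType disp)
      (P : probability T R) (X : 'I_d -> {RV P >-> R}),
      (r <= d)%N ->
      Theta^T *m Theta = 1%:M ->
      standard_gaussian X ->
      let f := fun x : 'cV[R]_d => g (Theta^T *m x) in
      ('V_P[f \o random_vector X])%E = sigma2%:E /\
      (0 < sigma2 ->
       mean_dimension X f <= r%:R * (C / Num.sqrt sigma2) ^+ 2).
Proof.
have hg1 := lipschitz_euclid_lipschitz1 hg.
have [s2 hs2] := gaussian_variance_unique hg1.
exists s2 => d Theta disp T P X rd TT /gaussian_random_vector gV f.
have varE : ('V_P[f \o random_vector X] = s2%:E)%E.
  exact: hs2 (orthonormal_gaussian rd TT gV).
split=> // s20.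
have hf : lipschitz1 f by exact: lipschitz1_mulmx.
have sqV := gaussian_sqr_integrable gV; have indV := gaussian_indep gV.
have s2E : inner P (random_vector X) f f
    - (\int[P]_w f (random_vector X w)) ^+ 2 = s2.
  by apply: EFin_inj; rewrite -variance_lipschitz1//; exact: gV.1.
have bound := mean_dimension_le (b := fun j => C ^+ 2 * \sum_i Theta j i ^+ 2)
  indV sqV hf.
rewrite s2E -mulr_sumr sum_sqr_orthonormal// in bound.
rewrite expr_div_n (sqr_sqrtr (ltW s20)) mulrCA mulrA; apply: bound => // j.
exists (fun x => f (mix (~: [set j])%SET x 0)); split.
- exact: lipschitz1_mixl.
- by move=> x y; rewrite mix_mixl.
have hh := lipschitz1B hf (lipschitz1_mixl (~: [set j])%SET 0 hf).
set b := C ^+ 2 * _; have b0 : 0 <= b.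
  by rewrite mulr_ge0 ?sqr_ge0// sumr_ge0// => i _; exact: sqr_ge0.
(* The pointwise bound for moving coordinate [j] to 0 is integrated; the remaining second moment of
   that coordinate is at most 1. *)
apply: (@le_trans _ _ (\int[P]_w (b * random_vector X w j ord0 ^+ 2))).
  apply: le_Rintegral => //.
  - exact: (integrable_lipschitz1M gV.1 sqV hh hh).
  - exact: (integrableZl measurableT b (sqV j)).
  - by move=> w _; rewrite -expr2; exact: lipschitz_euclid_coord.
rewrite (RintegralZl _ measurableT (sqV j)).
rewrite ler_piMr//.
by rewrite -lee_fin /Rintegral fineK ?gaussian_second_moment_le1//;
  exact: integrable_fin_num.
Qed.
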